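(* If the geometric realization of $C(n_1,n_2,n_3)$ is a surface without boundary, then it is homeomorphic either to a disjoint union of tori or to a disjoint union of 2-spheres.
   Context: Standing conventions: $N,n_1,n_2,n_3$ are positive integers with $n_1+n_2+n_3=N$ and $1\le n_1\le n_2\le n_3<N$. $C(n_1,n_2,n_3)$ denotes the abstract simplicial complex whose vertex set is $\mathbb{Z}/N$, whose 2-simplices are all sets of the form $\{k,k+n_1,k+n_1+n_2\}$ or $\{k,k-n_1,k-n_1-n_2\}$ for $k\in\mathbb{Z}/N$ (i.e. the orbit of $\{0,n_1,n_1+n_2\}$ under all translations $x\mapsto x+t$ and inversions $x\mapsto t-x$ of $\mathbb{Z}/N$), and whose 1-simplices are all sets $\{k,k+n_i\}$ with $k\in\mathbb{Z}/N$, $i\in\{1,2,3\}$. A surface without boundary is a second countable Hausdorff space locally homeomorphic to open subsets of $\mathbb{R}^2$. *)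

(* Defs.v *)
(* classical reals.  Topological spaces are realised concretely as
   subsets of Euclidean space R^d (points are functions nat -> R whose
   coordinates of index >= d vanish), with the subspace topology induced by the
   Euclidean metric. *)
From Stdlib Require Import Reals List Arith.
Import ListNotations.
Open Scope R_scope.

Fixpoint rsum (d : nat) (f : nat -> R) : R :=
  match d with
  | O => 0
  | S d' => rsum d' f + f d'
  end.

Definition in_Rd (d : nat) (x : nat -> R) : Prop :=
  forall i, (d <= i)%nat -> x i = 0.

Definition dist (d : nat) (x y : nat -> R) : R :=
  sqrt (rsum d (fun i => (x i - y i) ^ 2)).

Definition space := (nat -> R) -> Prop.

Definition continuous_on (d1 d2 : nat) (A : space) (f : (nat -> R) -> (nat -> R)) : Prop :=
  forall x, A x -> forall eps, 0 < eps ->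
    exists delta, 0 < delta /\
      forall y, A y -> dist d1 x y < delta -> dist d2 (f x) (f y) < eps.

Definition homeomorphic (d1 : nat) (A : space) (d2 : nat) (B : space) : Prop :=
  exists (f g : (nat -> R) -> (nat -> R)),
    (forall x, A x -> B (f x)) /\ (forall y, B y -> A (g y)) /\
    (forall x, A x -> g (f x) = x) /\ (forall y, B y -> f (g y) = y) /\
    continuous_on d1 d2 A f /\ continuous_on d2 d1 B g.

Definition rel_open (d : nat) (A U : space) : Prop :=
  (forall y, U y -> A y) /\
  forall y, U y -> exists r, 0 < r /\ forall z, A z -> dist d y z < r -> U z.

(* A ⊆ R^d is a surface without boundary: every point has an open
   neighbourhood homeomorphic to an open subset of R^2.  (Hausdorff and second
   countability hold automatically for subspaces of R^d.) *)
Definition is_surface (d : nat) (A : space) : Prop :=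
  (forall x, A x -> in_Rd d x) /\
  forall x, A x -> exists (U V : space),
    U x /\ rel_open d A U /\ rel_open 2 (in_Rd 2) V /\ homeomorphic d U 2 V.

(* the simplices of C(n1,n2,n3), as lists of vertices.  The 2-simplices are the
   orbit of {0,n1,n1+n2} under translations and inversions, i.e. the sets
   {k,k+n1,k+n1+n2} and {k,k-n1,k-n1-n2} (mod N); the 1-simplices are
   {k,k+n_i}; the 0-simplices are the vertices. *)
Definition simplex_C (N n1 n2 n3 : nat) (s : list nat) : Prop :=
  (exists k, (k < N)%nat /\ s = [k]) \/
  (exists k j, (k < N)%nat /\ (j = n1 \/ j = n2 \/ j = n3) /\
     s = [k; ((k + j) mod N)%nat]) \/
  (exists k, (k < N)%nat /\
     (s = [k; ((k + n1) mod N)%nat; ((k + n1 + n2) mod N)%nat] \/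
      s = [k; ((k + (N - n1)) mod N)%nat; ((k + (N - n1) + (N - n2)) mod N)%nat])).

(* geometric realization |C(n1,n2,n3)| ⊆ R^N: barycentric coordinate vectors
   whose support is contained in a simplex of the complex *)
Definition realization (N n1 n2 n3 : nat) : space :=
  fun x =>
    in_Rd N x /\ (forall i, 0 <= x i) /\ rsum N x = 1 /\
    exists s, simplex_C N n1 n2 n3 s /\
      forall i, (i < N)%nat -> x i <> 0 -> In i s.

(* disjoint union of k standard tori: the j-th copy lies in the slice x_3 = j *)
Definition tori (k : nat) : space :=
  fun x => in_Rd 4 x /\
    (exists j, (j < k)%nat /\ x 3%nat = INR j) /\
    (sqrt (x 0%nat ^ 2 + x 1%nat ^ 2) - 2) ^ 2 + x 2%nat ^ 2 = 1.

Definition spheres (k : nat) : space :=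
  fun x => in_Rd 4 x /\
    (exists j, (j < k)%nat /\ x 3%nat = INR j) /\
    x 0%nat ^ 2 + x 1%nat ^ 2 + x 2%nat ^ 2 = 1.

(* Main.v *)
(** The complex [C(n1,n2,n3)] is the quotient of the plane, triangulated with vertex set
    Z^2 and edge directions (1,0), (0,1), (1,1), under the map (a,b) |-> a n1 + b n2 mod N.

    If n1 < n2 < n3 and n3 <> n1 + n2, the six neighbours of a vertex are distinct, so
    that a point of the realization determines its lifts up to the lattice of periods
    {(a,b) : N | a n1 + b n2}.  A compact square times {0, ..., g - 1}, where
    g = gcd(n1,n2,N), then maps onto the realization and onto g tori with the same fibres;
    by compactness the two targets are homeomorphic.  If (n1,n2,n3) = (n,n,2n), the
    realization consists of n boundaries of tetrahedra, which project radially to spheres.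

    In the remaining cases some edge lies in exactly one triangle (n1 = n2 or n2 = n3), or
    in more than two (n3 = n1 + n2).  A chart at the midpoint of such an edge would give a
    retraction of a square onto its boundary, against the Poincaré–Miranda theorem, which
    follows from Sperner's lemma. *)

From Stdlib Require Import Reals List Arith ZArith Lia Lra.
From Stdlib Require Import Classical ClassicalEpsilon FunctionalExtensionality.
From Coquelicot Require Import Coquelicot.
Require Import Defs.
Import ListNotations.
Open Scope R_scope.

(** The cases are the possible coincidences among the neighbours ±n1, ±n2, ±n3 of 0 modulo N. As n1
    + n2 + n3 = N, no n_i + n_j with i <> j is N, and 2 n_i = N makes n_i the sum of the other two;
    so for n1 < n2 < n3 the only possible coincidence is n3 = -n3, that is n3 = n1 + n2. An edge of
    difference n_i has its apices at n_j and n_k from one of its ends. If n_j = n_k, the two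
    triangles merge and the edge is free. If 2 n3 = N, an edge of difference n3 is also its own
    reverse and collects the triangles of both orientations. For (n,n,2n) the two effects compensate
    each other, which is why this degenerate case survives. A chart is merely continuous, so each
    obstruction transports an explicit small square through it: from the plane to the complex and
    back for a free edge, from the complex to the plane and back for three pages. The number g is
    the index in Z/N of the subgroup generated by n1 and n2, whose cosets are the vertex sets of the
    components. *)

Lemma rsum_ext d f g : (forall i, (i < d)%nat -> f i = g i) -> rsum d f = rsum d g.
Proof.
  induction d as [|d IH]; intros H; simpl; [reflexivity|].
  rewrite IH, H; [reflexivity|lia|]. intros; apply H; lia.
Qed.

Lemma rsum_plus d f g : rsum d (fun i => f i + g i) = rsum d f + rsum d g.
Proof. induction d as [|d IH]; simpl; [lra|rewrite IH; lra]. Qed.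

Lemma rsum_scal d k f : rsum d (fun i => k * f i) = k * rsum d f.
Proof. induction d as [|d IH]; simpl; [lra|rewrite IH; lra]. Qed.

Lemma rsum_0 d f : (forall i, (i < d)%nat -> f i = 0) -> rsum d f = 0.
Proof.
  intros H; rewrite (rsum_ext d f (fun _ => 0 * 0)).
  - rewrite rsum_scal; lra.
  - intros i Hi; rewrite H; [lra|exact Hi].
Qed.

Lemma rsum_le d f g : (forall i, (i < d)%nat -> f i <= g i) -> rsum d f <= rsum d g.
Proof.
  induction d as [|d IH]; intros H; simpl; [lra|].
  apply Rplus_le_compat; [apply IH; intros; apply H; lia|apply H; lia].
Qed.

Lemma rsum_nonneg d f : (forall i, (i < d)%nat -> 0 <= f i) -> 0 <= rsum d f.
Proof. intros H; rewrite <- (rsum_0 d (fun _ => 0)) by reflexivity; apply rsum_le, H. Qed.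

Definition delta (a i : nat) : R := if Nat.eqb i a then 1 else 0.

Lemma delta_same a : delta a a = 1.
Proof. unfold delta; rewrite Nat.eqb_refl; reflexivity. Qed.

Lemma delta_diff a i : i <> a -> delta a i = 0.
Proof. intros H; unfold delta; rewrite (proj2 (Nat.eqb_neq i a) H); reflexivity. Qed.

Lemma rsum_delta_mul d a f : (a < d)%nat -> rsum d (fun i => delta a i * f i) = f a.
Proof.
  induction d as [|d IH]; intros H; [lia|]; simpl.
  destruct (Nat.eq_dec a d) as [->|Hne].
  - rewrite rsum_0, delta_same; [lra|].
    intros i Hi; rewrite delta_diff; [lra|lia].
  - rewrite IH, delta_diff; [lra|lia|lia].
Qed.

Lemma rsum_delta d a : (a < d)%nat -> rsum d (delta a) = 1.
Proof.
  intros H; rewrite (rsum_ext d _ (fun i => delta a i * 1)) by (intros; lra).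
  apply (rsum_delta_mul d a (fun _ => 1) H).
Qed.

Lemma rsum_term_le d f i :
  (forall j, (j < d)%nat -> 0 <= f j) -> (i < d)%nat -> f i <= rsum d f.
Proof.
  intros H Hi; rewrite <- (rsum_delta_mul d i f Hi); apply rsum_le.
  intros j Hj; specialize (H j Hj); unfold delta; destruct (Nat.eqb j i); lra.
Qed.

Lemma rsum_swap d e f :
  rsum d (fun i => rsum e (fun j => f i j)) = rsum e (fun j => rsum d (fun i => f i j)).
Proof.
  induction d as [|d IH]; simpl.
  - rewrite rsum_0; reflexivity.
  - rewrite IH, <- rsum_plus; reflexivity.
Qed.

(** * Euclidean distance versus coordinatewise estimates *)

Lemma coord_le_dist d x y i : (i < d)%nat -> Rabs (x i - y i) <= dist d x y.
Proof.
  intros Hi; unfold dist; rewrite <- sqrt_Rsqr_abs, Rsqr_pow2; apply sqrt_le_1_alt.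
  apply (rsum_term_le d (fun i => (x i - y i) ^ 2)); [|exact Hi].
  intros; apply pow2_ge_0.
Qed.

Lemma dist_le_of_coords d x y e :
  0 <= e -> (forall i, (i < d)%nat -> Rabs (x i - y i) <= e) -> dist d x y <= INR d * e.
Proof.
  intros He H; unfold dist.
  assert (Hsq : rsum d (fun i => (x i - y i) ^ 2) <= (INR d * e) ^ 2).
  { revert H; induction d as [|d IH]; intros H; [simpl; lra|].
    rewrite S_INR; cbn [rsum].
    assert (H1 := IH (fun i Hi => H i (Nat.lt_trans _ _ _ Hi (Nat.lt_succ_diag_r d)))).
    assert (H2 := H d (Nat.lt_succ_diag_r d)).
    rewrite <- (pow2_abs (x d - y d)).
    assert (0 <= Rabs (x d - y d)) by apply Rabs_pos.
    assert (0 <= INR d) by apply pos_INR.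
    assert (Rabs (x d - y d) ^ 2 <= e ^ 2) by (apply pow_incr; lra).
    assert (0 <= INR d * e * e) by (repeat apply Rmult_le_pos; lra). nra. }
  rewrite <- (sqrt_pow2 (INR d * e)); [apply sqrt_le_1_alt, Hsq|].
  apply Rmult_le_pos; [apply pos_INR|lra].
Qed.

Lemma dist_lt_of_coords d x y r :
  0 < r -> (forall i, (i < d)%nat -> Rabs (x i - y i) <= r / (INR d + 1)) -> dist d x y < r.
Proof.
  intros Hr H. assert (H0 := pos_INR d).
  assert (Hp : 0 < / (INR d + 1)) by (apply Rinv_0_lt_compat; lra).
  assert (Hq : (INR d + 1) * / (INR d + 1) = 1) by (field; lra).
  apply Rle_lt_trans with (INR d * (r / (INR d + 1))).
  - apply dist_le_of_coords; [unfold Rdiv; nra|exact H].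
  - unfold Rdiv; nra.
Qed.

Lemma in_Rd_ext d x y :
  in_Rd d x -> in_Rd d y -> (forall i, (i < d)%nat -> x i = y i) -> x = y.
Proof.
  intros Hx Hy H; apply functional_extensionality; intros i.
  destruct (Nat.lt_ge_cases i d) as [Hi|Hi]; [apply H, Hi|].
  rewrite Hx, Hy; [reflexivity|exact Hi|exact Hi].
Qed.

(** * Continuity *)

(** Neighbourhoods of [x] within [A], as a filter, so that the composition rules for [filterlim]
    apply to functions on a subset of R^d. *)
Definition near (d : nat) (A : space) (x : nat -> R) : ((nat -> R) -> Prop) -> Prop :=
  fun P => exists e, 0 < e /\ forall y, A y -> dist d x y < e -> P y.

#[local] Instance near_filter d A x : Filter (near d A x).
Proof.
  split.
  - exists 1; split; [lra|auto].
  - intros P Q (e & He & HP) (e' & He' & HQ). exists (Rmin e e'); split.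
    + apply Rmin_glb_lt; assumption.
    + intros y Hy Hd; split; [apply HP|apply HQ]; auto;
        eapply Rlt_le_trans; try exact Hd; [apply Rmin_l|apply Rmin_r].
  - intros P Q H (e & He & HP); exists e; split; auto.
Qed.

Definition rcont (d : nat) (A : space) (h : (nat -> R) -> R) : Prop :=
  forall x, A x -> filterlim h (near d A x) (locally (h x)).

Lemma near_in d A x : near d A x A.
Proof. exists 1; split; [lra|auto]. Qed.

Lemma rcont_eps d A h x e :
  rcont d A h -> A x -> 0 < e -> near d A x (fun y => Rabs (h y - h x) < e).
Proof.
  intros Hh Hx He. exact (Hh x Hx _ (locally_ball (h x) (mkposreal e He))).
Qed.

Lemma eps_rcont d A h :
  (forall x, A x -> forall e, 0 < e -> near d A x (fun y => Rabs (h y - h x) < e)) ->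
  rcont d A h.
Proof.
  intros H x Hx P [e He]. unfold filtermap.
  generalize (H x Hx e (cond_pos e)); apply filter_imp; intros y Hy; apply He, Hy.
Qed.

Lemma rcont_ext d A h k :
  (forall x, A x -> h x = k x) -> rcont d A h -> rcont d A k.
Proof.
  intros E Hh x Hx. rewrite <- E by exact Hx.
  apply (filterlim_ext_loc h); [|apply Hh, Hx].
  generalize (near_in d A x); apply filter_imp; intros y Hy; apply E, Hy.
Qed.

Lemma rcont_const d A k : rcont d A (fun _ => k).
Proof. intros x _; apply filterlim_const. Qed.

Lemma rcont_coord d A i : (i < d)%nat -> rcont d A (fun x => x i).
Proof.
  intros Hi; apply eps_rcont; intros x Hx e He; exists e; split; [exact He|].
  intros y _ Hd; rewrite Rabs_minus_sym.
  eapply Rle_lt_trans; [apply coord_le_dist, Hi|exact Hd].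
Qed.

Lemma rcont_plus d A h k :
  rcont d A h -> rcont d A k -> rcont d A (fun x => h x + k x).
Proof.
  intros Hh Hk x Hx. eapply filterlim_comp_2; [apply Hh, Hx|apply Hk, Hx|].
  apply (filterlim_plus (V := R_NormedModule)).
Qed.

Lemma rcont_mult d A h k :
  rcont d A h -> rcont d A k -> rcont d A (fun x => h x * k x).
Proof.
  intros Hh Hk x Hx. eapply filterlim_comp_2; [apply Hh, Hx|apply Hk, Hx|].
  apply (filterlim_mult (K := R_AbsRing)).
Qed.

Lemma rcont_comp d A h (k : R -> R) :
  rcont d A h -> (forall x, A x -> continuous k (h x)) -> rcont d A (fun x => k (h x)).
Proof. intros Hh Hk x Hx. eapply filterlim_comp; [apply Hh, Hx|apply Hk, Hx]. Qed.

Lemma rcont_opp d A h : rcont d A h -> rcont d A (fun x => - h x).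
Proof.
  intros H; apply (rcont_ext d A (fun x => (-1) * h x)); [intros; ring|].
  apply rcont_mult; [apply rcont_const|exact H].
Qed.

Lemma rcont_minus d A h k :
  rcont d A h -> rcont d A k -> rcont d A (fun x => h x - k x).
Proof. intros; apply rcont_plus; [|apply rcont_opp]; assumption. Qed.

Lemma rcont_abs d A h : rcont d A h -> rcont d A (fun x => Rabs (h x)).
Proof. intros H; apply rcont_comp; [exact H|intros; apply continuous_Rabs]. Qed.

Lemma rcont_max d A h k :
  rcont d A h -> rcont d A k -> rcont d A (fun x => Rmax (h x) (k x)).
Proof.
  intros Hh Hk; apply (rcont_ext d A (fun x => (h x + k x + Rabs (h x - k x)) * / 2)).
  - intros x _; unfold Rmax, Rabs; destruct (Rle_dec _ _), (Rcase_abs _); lra.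
  - apply rcont_mult; [|apply rcont_const].
    apply rcont_plus; [apply rcont_plus; assumption|].
    apply rcont_abs, rcont_minus; assumption.
Qed.

Lemma rcont_min d A h k :
  rcont d A h -> rcont d A k -> rcont d A (fun x => Rmin (h x) (k x)).
Proof.
  intros Hh Hk; apply (rcont_ext d A (fun x => - Rmax (- h x) (- k x))).
  - intros x _; unfold Rmax, Rmin; repeat destruct (Rle_dec _ _); lra.
  - apply rcont_opp, rcont_max; apply rcont_opp; assumption.
Qed.

Lemma rcont_inv d A h :
  rcont d A h -> (forall x, A x -> h x <> 0) -> rcont d A (fun x => / h x).
Proof.
  intros Hh H0; apply rcont_comp; [exact Hh|]. intros x Hx.
  apply continuous_Rinv, H0, Hx.
Qed.

Lemma rcont_pow d A h n : rcont d A h -> rcont d A (fun x => h x ^ n).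
Proof.
  intros H; induction n as [|n IH]; simpl; [apply rcont_const|].
  apply rcont_mult; assumption.
Qed.

Lemma rcont_sqrt d A h : rcont d A h -> rcont d A (fun x => sqrt (h x)).
Proof. intros H; apply rcont_comp; [exact H|intros; apply continuous_sqrt]. Qed.

Lemma rcont_cos d A h : rcont d A h -> rcont d A (fun x => cos (h x)).
Proof. intros H; apply rcont_comp; [exact H|intros; apply continuous_cos]. Qed.

Lemma rcont_sin d A h : rcont d A h -> rcont d A (fun x => sin (h x)).
Proof. intros H; apply rcont_comp; [exact H|intros; apply continuous_sin]. Qed.

Lemma rcont_rsum d A m (h : nat -> (nat -> R) -> R) :
  (forall j, (j < m)%nat -> rcont d A (h j)) -> rcont d A (fun x => rsum m (fun j => h j x)).
Proof.
  induction m as [|m IH]; intros H; simpl; [apply rcont_const|].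
  apply rcont_plus; [apply IH; intros; apply H; lia|apply H; lia].
Qed.

Ltac rcont_tac :=
  lazymatch goal with
  | |- rcont _ _ (fun _ => ?c) => apply rcont_const
  | |- rcont ?d ?A (fun x => x ?i) => apply (rcont_coord d A i); try lia
  | |- rcont ?d ?A (fun x => @?h x + @?k x) => apply (rcont_plus d A h k); rcont_tac
  | |- rcont ?d ?A (fun x => @?h x - @?k x) => apply (rcont_minus d A h k); rcont_tac
  | |- rcont ?d ?A (fun x => @?h x * @?k x) => apply (rcont_mult d A h k); rcont_tac
  | |- rcont ?d ?A (fun x => @?h x / @?k x) =>
      apply (rcont_mult d A h (fun x => / k x)); rcont_tac
  | |- rcont ?d ?A (fun x => - @?h x) => apply (rcont_opp d A h); rcont_tac
  | |- rcont ?d ?A (fun x => Rabs (@?h x)) => apply (rcont_abs d A h); rcont_tac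
  | |- rcont ?d ?A (fun x => Rmax (@?h x) (@?k x)) => apply (rcont_max d A h k); rcont_tac
  | |- rcont ?d ?A (fun x => Rmin (@?h x) (@?k x)) => apply (rcont_min d A h k); rcont_tac
  | |- rcont ?d ?A (fun x => @?h x ^ ?n) => apply (rcont_pow d A h n); rcont_tac
  | |- rcont ?d ?A (fun x => sqrt (@?h x)) => apply (rcont_sqrt d A h); rcont_tac
  | |- rcont ?d ?A (fun x => cos (@?h x)) => apply (rcont_cos d A h); rcont_tac
  | |- rcont ?d ?A (fun x => sin (@?h x)) => apply (rcont_sin d A h); rcont_tac
  | _ => idtac
  end.

Lemma near_forall_lt d A x m (P : nat -> (nat -> R) -> Prop) :
  (forall i, (i < m)%nat -> near d A x (P i)) ->
  near d A x (fun y => forall i, (i < m)%nat -> P i y).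
Proof.
  induction m as [|m IH]; intros H.
  - generalize (near_in d A x); apply filter_imp; intros; lia.
  - assert (H1 : near d A x (P m)) by (apply H; lia).
    assert (H2 : near d A x (fun y => forall i, (i < m)%nat -> P i y))
      by (apply IH; intros; apply H; lia).
    generalize (filter_and _ _ H1 H2); apply filter_imp; intros y [Ha Hb] i Hi.
    destruct (Nat.eq_dec i m) as [->|]; [exact Ha|apply Hb; lia].
Qed.

Lemma continuous_on_coords d1 d2 A f :
  (forall i, (i < d2)%nat -> rcont d1 A (fun x => f x i)) -> continuous_on d1 d2 A f.
Proof.
  intros H x Hx e He.
  assert (H0 := pos_INR d2).
  assert (Hp : 0 < e / (INR d2 + 1)) by (apply Rdiv_lt_0_compat; lra).
  destruct (near_forall_lt d1 A x d2 (fun i y => Rabs (f y i - f x i) < e / (INR d2 + 1)))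
    as (r & Hr & Hy).
  - intros i Hi; apply (rcont_eps d1 A (fun x => f x i)); auto.
  - exists r; split; [exact Hr|]; intros y HAy Hd.
    apply dist_lt_of_coords; [exact He|]; intros i Hi.
    rewrite Rabs_minus_sym; left; apply Hy; assumption.
Qed.

Lemma rcont_of_continuous_on d1 d2 A f i :
  continuous_on d1 d2 A f -> (i < d2)%nat -> rcont d1 A (fun x => f x i).
Proof.
  intros H Hi; apply eps_rcont; intros x Hx e He.
  destruct (H x Hx e He) as (r & Hr & Hy); exists r; split; [exact Hr|].
  intros y HAy Hd; rewrite Rabs_minus_sym.
  eapply Rle_lt_trans; [apply coord_le_dist, Hi|apply Hy; assumption].
Qed.

Lemma rcont_comp_map d1 d2 A B f h :
  (forall x, A x -> B (f x)) -> continuous_on d1 d2 A f -> rcont d2 B h ->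
  rcont d1 A (fun x => h (f x)).
Proof.
  intros HAB Hf Hh x Hx P HP.
  destruct (Hh (f x) (HAB x Hx) P HP) as (e & He & Hy).
  destruct (Hf x Hx e He) as (r & Hr & Hz).
  exists r; split; [exact Hr|]; intros y HAy Hd; apply Hy; auto.
Qed.

(** * Compactness *)

(** Cluster points replace limits of subsequences: the arguments below only need arbitrarily late
    terms close to [l]. *)
Definition cluster (d : nat) (u : nat -> nat -> R) (l : nat -> R) : Prop :=
  forall e, 0 < e -> forall n, exists m, (n <= m)%nat /\ dist d l (u m) < e.

Definition seq_compact (d : nat) (K : space) : Prop :=
  forall u : nat -> nat -> R, (forall n, K (u n)) -> exists l, K l /\ cluster d u l.

Lemma bounded_subsequence (v : nat -> R) B :
  (forall n, Rabs (v n) <= B) ->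
  exists (phi : nat -> nat) (l : R), (forall n, (n <= phi n)%nat) /\ is_lim_seq (fun n => v (phi n)) l.
Proof.
  intros HB.
  destruct (Bolzano_Weierstrass v (fun c => - B <= c <= B) (compact_P3 (- B) B)) as [l Hl].
  { intros n; apply Rabs_le_between, HB. }
  assert (H : forall n : nat, exists m, (n <= m)%nat /\ Rabs (v m - l) < / (INR n + 1)).
  { intros n. assert (H0 : 0 < / (INR n + 1)) by apply RinvN_pos.
    destruct (Hl (fun y => Rabs (y - l) < / (INR n + 1)) n) as (m & Hm & Hv).
    - exists (mkposreal _ H0); intros y Hy; exact Hy.
    - exists m; auto. }
  destruct (choice _ H) as [phi Hphi].
  exists phi, l; split; [apply Hphi|].
  apply is_lim_seq_spec; intros e.
  destruct (archimed_cor1 e (cond_pos e)) as (n0 & Hn0 & Hpos).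
  exists n0; intros n Hn. eapply Rlt_trans; [apply Hphi|].
  eapply Rlt_trans; [|exact Hn0].
  assert (0 < INR n0) by (apply lt_0_INR; exact Hpos).
  apply le_INR in Hn. apply Rinv_lt_contravar; nra.
Qed.

(** One coordinate is extracted after another. Of an extraction only [n <= phi n] is asked, not
    monotonicity: limits pass along it, and the property survives composition. *)
Lemma bounded_subsequence_Rd d (u : nat -> nat -> R) B :
  (forall n i, (i < d)%nat -> Rabs (u n i) <= B) ->
  exists (phi : nat -> nat) l, (forall n, (n <= phi n)%nat) /\
    forall i, (i < d)%nat -> is_lim_seq (fun n => u (phi n) i) (Finite (l i)).
Proof.
  induction d as [|d IH]; intros H.
  - exists (fun n => n), (fun _ => 0); split; intros; lia.
  - destruct IH as (phi & l & Hphi & Hl); [intros; apply H; lia|].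
    destruct (bounded_subsequence (fun n => u (phi n) d) B) as (psi & m & Hpsi & Hm);
      [intros; apply H; lia|].
    exists (fun n => phi (psi n)), (fun i => if Nat.eqb i d then m else l i); split.
    + intros n; eapply Nat.le_trans; [apply Hpsi|apply Hphi].
    + intros i Hi. destruct (Nat.eqb_spec i d) as [->|Hne]; [exact Hm|].
      apply (is_lim_seq_subseq (fun n => u (phi n) i)); [|apply Hl; lia].
      intros P [n0 HP]; exists n0; intros n Hn; apply HP; eapply Nat.le_trans; eauto.
Qed.

Lemma closed_bounded_compact d (K : space) B :
  (forall x, K x -> in_Rd d x) ->
  (forall x i, K x -> Rabs (x i) <= B) ->
  (forall l, in_Rd d l -> (forall e, 0 < e -> exists y, K y /\ dist d l y < e) -> K l) ->
  seq_compact d K.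
Proof.
  intros Hin HB Hcl u Hu.
  destruct (bounded_subsequence_Rd d u B) as (phi & l & Hphi & Hl); [intros; apply HB, Hu|].
  (* The extraction controls only the first [d] coordinates; the others are set to 0 so that [l']
     lies in R^d. *)
  set (l' := fun i => if Nat.ltb i d then l i else 0).
  assert (Hc : cluster d u l').
  { intros e He n. assert (H0 := pos_INR d).
    assert (Hp : 0 < e / (INR d + 1)) by (apply Rdiv_lt_0_compat; lra).
    assert (Hev : forall k, (k <= d)%nat -> exists n0, forall n, (n0 <= n)%nat ->
      forall i, (i < k)%nat -> Rabs (u (phi n) i - l i) < e / (INR d + 1)).
    { induction k as [|k IH]; intros Hk; [exists O; intros; lia|].
      destruct IH as [n0 Hn0]; [lia|].
      assert (Hlk := Hl k ltac:(lia)). apply is_lim_seq_spec in Hlk.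
      destruct (Hlk (mkposreal _ Hp)) as [n1 Hn1].
      exists (Nat.max n0 n1); intros m Hm i Hi.
      destruct (Nat.eq_dec i k) as [->|]; [apply Hn1; lia|apply Hn0; lia]. }
    destruct (Hev d (Nat.le_refl d)) as [n0 Hn0].
    exists (phi (Nat.max n n0)); split; [specialize (Hphi (Nat.max n n0)); lia|].
    apply dist_lt_of_coords; [exact He|]; intros i Hi; unfold l'.
    rewrite (proj2 (Nat.ltb_lt i d) Hi), Rabs_minus_sym; left; apply Hn0; lia. }
  exists l'; split; [|exact Hc]. apply Hcl.
  - intros i Hi; unfold l'; rewrite (proj2 (Nat.ltb_ge i d) Hi); reflexivity.
  - intros e He; destruct (Hc e He O) as (m & _ & Hm); eauto.
Qed.

(** If [f] were discontinuous at [x], points [u n] of [K] would exist with [G (u n)] tending to [x]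
    but [H (u n)] away from [f x]. At a cluster point [l] of [u] one has [G l = x], hence
    [H l = f x], against the continuity of [H] at [l]. *)
Lemma quotient_map_continuous d d1 d2 (K X : space) G H f :
  seq_compact d K ->
  (forall p, K p -> X (G p)) -> (forall x, X x -> exists p, K p /\ G p = x) ->
  continuous_on d d1 K G -> continuous_on d d2 K H ->
  (forall x y, X x -> X y -> dist d1 x y = 0 -> x = y) ->
  (forall p, K p -> f (G p) = H p) ->
  continuous_on d1 d2 X f.
Proof.
  intros HK HGX Hsurj HG HH Hsep Hf x Hx e He.
  apply NNPP; intros Hno.
  assert (Hbad : forall n : nat, exists p, K p /\ dist d1 x (G p) < / (INR n + 1) /\
                 e <= dist d2 (f x) (H p)).
  { intros n; apply NNPP; intros Hn; apply Hno.
    exists (/ (INR n + 1)); split; [apply RinvN_pos|].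
    intros y Hy Hd. destruct (Hsurj y Hy) as (p & Hp & <-).
    apply Rnot_le_lt; intros Hle; apply Hn; exists p; rewrite <- (Hf p Hp); auto. }
  destruct (choice _ Hbad) as [u Hu].
  destruct (HK u) as (l & Hl & Hcl); [apply Hu|].
  assert (Exl : x = G l).
  { apply Hsep; auto. apply Rle_antisym; [|apply sqrt_pos].
    apply le_epsilon; intros e' He'; rewrite Rplus_0_l.
    assert (Hd0 := pos_INR d1).
    assert (He2 : 0 < e' / (INR d1 + 1) / 2).
    { assert (0 < e' / (INR d1 + 1)) by (apply Rdiv_lt_0_compat; lra); lra. }
    left; apply dist_lt_of_coords; [exact He'|]; intros i Hi.
    destruct (HG l Hl _ He2) as (r & Hr & HGl).
    destruct (archimed_cor1 _ He2) as (n0 & Hn0 & Hpos).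
    destruct (Hcl r Hr n0) as (m & Hm & Hdm).
    assert (H1 : Rabs (G l i - G (u m) i) < e' / (INR d1 + 1) / 2).
    { eapply Rle_lt_trans; [apply coord_le_dist, Hi|apply HGl; [apply Hu|exact Hdm]]. }
    assert (H2 : Rabs (x i - G (u m) i) < e' / (INR d1 + 1) / 2).
    { eapply Rle_lt_trans; [apply coord_le_dist, Hi|].
      eapply Rlt_trans; [apply Hu|]. eapply Rlt_trans; [|exact Hn0].
      assert (0 < INR n0) by (apply lt_0_INR; exact Hpos).
      apply le_INR in Hm. apply Rinv_lt_contravar; nra. }
    revert H1 H2; unfold Rabs; repeat destruct (Rcase_abs _); lra. }
  destruct (HH l Hl e He) as (r & Hr & HHl).
  destruct (Hcl r Hr O) as (m & _ & Hdm).
  destruct (Hu m) as (HKm & _ & Hge).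
  rewrite Exl, (Hf l Hl) in Hge.
  specialize (HHl _ HKm Hdm); lra.
Qed.

Lemma dist_0_eq d x y : in_Rd d x -> in_Rd d y -> dist d x y = 0 -> x = y.
Proof.
  intros Hx Hy H; apply (in_Rd_ext d); auto; intros i Hi.
  assert (H1 := coord_le_dist d x y i Hi). rewrite H in H1.
  revert H1; unfold Rabs; destruct (Rcase_abs _); lra.
Qed.

(** The sections of [G] and [H] are chosen arbitrarily and need not be continuous, but equality of
    the fibres makes [H] after a section of [G] independent of the choice; the preceding lemma then
    gives continuity in both directions. *)
Lemma homeomorphic_of_same_fibres d d1 d2 (K X Y : space) G H :
  seq_compact d K ->
  (forall x, X x -> in_Rd d1 x) -> (forall y, Y y -> in_Rd d2 y) ->
  (forall p, K p -> X (G p)) -> (forall x, X x -> exists p, K p /\ G p = x) ->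
  (forall p, K p -> Y (H p)) -> (forall y, Y y -> exists p, K p /\ H p = y) ->
  continuous_on d d1 K G -> continuous_on d d2 K H ->
  (forall p q, K p -> K q -> (G p = G q <-> H p = H q)) ->
  homeomorphic d1 X d2 Y.
Proof.
  intros HK HX HY HGX HGs HHY HHs HGc HHc Hfib.
  set (sec := fun (F : (nat -> R) -> (nat -> R)) x =>
    epsilon (inhabits (fun _ : nat => 0)) (fun p => K p /\ F p = x)).
  assert (HsG : forall x, X x -> K (sec G x) /\ G (sec G x) = x)
    by (intros x Hx; apply epsilon_spec, HGs, Hx).
  assert (HsH : forall y, Y y -> K (sec H y) /\ H (sec H y) = y)
    by (intros y Hy; apply epsilon_spec, HHs, Hy).
  assert (EH : forall p, K p -> H (sec G (G p)) = H p).
  { intros p Hp; destruct (HsG (G p) (HGX p Hp)); apply Hfib; auto. }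
  assert (EG : forall p, K p -> G (sec H (H p)) = G p).
  { intros p Hp; destruct (HsH (H p) (HHY p Hp)); apply Hfib; auto. }
  exists (fun x => H (sec G x)), (fun y => G (sec H y)); repeat split.
  - intros x Hx; apply HHY, HsG, Hx.
  - intros y Hy; apply HGX, HsH, Hy.
  - intros x Hx; destruct (HsG x Hx) as [HKs Es]; rewrite EG; assumption.
  - intros y Hy; destruct (HsH y Hy) as [HKs Es]; rewrite EH; assumption.
  - apply (quotient_map_continuous d d1 d2 K X G H); auto.
    intros x y Hx Hy; apply dist_0_eq; auto.
  - apply (quotient_map_continuous d d2 d1 K Y H G); auto.
    intros x y Hx Hy; apply dist_0_eq; auto.
Qed.

Lemma closed_le d K h l c :
  rcont d (fun _ => True) h -> (forall x, K x -> h x <= c) ->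
  (forall e, 0 < e -> exists y, K y /\ dist d l y < e) -> h l <= c.
Proof.
  intros Hh HK Hl. apply Rnot_lt_le; intros Hlt.
  destruct (rcont_eps d (fun _ => True) h l (h l - c) Hh I) as (r & Hr & Hy); [lra|].
  destruct (Hl r Hr) as (y & HKy & Hd). specialize (Hy y I Hd). specialize (HK y HKy).
  apply Rabs_lt_between in Hy; lra.
Qed.

Lemma closed_eq d K h l c :
  rcont d (fun _ => True) h -> (forall x, K x -> h x = c) ->
  (forall e, 0 < e -> exists y, K y /\ dist d l y < e) -> h l = c.
Proof.
  intros Hh HK Hl; apply Rle_antisym.
  - apply (closed_le d K h l c); auto. intros x Hx; right; auto.
  - apply Ropp_le_cancel, (closed_le d K (fun x => - h x) l (- c)); auto.
    + apply rcont_opp, Hh.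
    + intros x Hx; right; rewrite (HK x Hx); reflexivity.
Qed.

(** Induction on the number of levels: if [x] is not the top level, radii below its distance to that
    level leave only the lower ones. *)
Lemma approx_INR k x :
  (forall e, 0 < e -> exists j, (j < k)%nat /\ Rabs (x - INR j) < e) ->
  exists j, (j < k)%nat /\ x = INR j.
Proof.
  induction k as [|k IH]; intros H.
  - destruct (H 1 Rlt_0_1) as (j & Hj & _); lia.
  - destruct (Req_dec x (INR k)) as [E|Hne]; [exists k; split; [lia|exact E]|].
    destruct IH as (j & Hj & E); [|exists j; split; [lia|exact E]].
    intros e He.
    assert (Hp : 0 < Rabs (x - INR k)) by (apply Rabs_pos_lt; lra).
    destruct (H (Rmin e (Rabs (x - INR k)))) as (j & Hj & Hd);
      [apply Rmin_glb_lt; assumption|].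
    assert (Hm1 := Rmin_l e (Rabs (x - INR k))). assert (Hm2 := Rmin_r e (Rabs (x - INR k))).
    exists j; split; [|lra].
    assert (j <> k) by (intros ->; lra). lia.
Qed.

Lemma closed_level d K l i k :
  (i < d)%nat -> (forall x, K x -> exists j, (j < k)%nat /\ x i = INR j) ->
  (forall e, 0 < e -> exists y, K y /\ dist d l y < e) ->
  exists j, (j < k)%nat /\ l i = INR j.
Proof.
  intros Hi HK Hl; apply approx_INR; intros e He.
  destruct (Hl e He) as (y & Hy & Hd). destruct (HK y Hy) as (j & Hj & E).
  exists j; split; [exact Hj|]. rewrite <- E.
  eapply Rle_lt_trans; [apply coord_le_dist, Hi|exact Hd].
Qed.

(** * The Poincaré–Miranda theorem on the square *)

Definition edge12 (p q : nat) : bool :=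
  (Nat.eqb p 1 && Nat.eqb q 2) || (Nat.eqb p 2 && Nat.eqb q 1).

Fixpoint xorsum (n : nat) (f : nat -> bool) : bool :=
  match n with
  | O => false
  | S n' => xorb (xorsum n' f) (f n')
  end.

Definition trichromatic (p q r : nat) : Prop :=
  (p = 0 \/ q = 0 \/ r = 0)%nat /\ (p = 1 \/ q = 1 \/ r = 1)%nat /\
  (p = 2 \/ q = 2 \/ r = 2)%nat.

Lemma not_trichromatic_edges p q r :
  (p <= 2)%nat -> (q <= 2)%nat -> (r <= 2)%nat -> ~ trichromatic p q r ->
  xorb (edge12 p q) (xorb (edge12 q r) (edge12 p r)) = false.
Proof.
  intros Hp Hq Hr H.
  assert (Ep : (p = 0 \/ p = 1 \/ p = 2)%nat) by lia.
  assert (Eq : (q = 0 \/ q = 1 \/ q = 2)%nat) by lia.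
  assert (Er : (r = 0 \/ r = 1 \/ r = 2)%nat) by lia.
  destruct Ep as [-> | [-> | ->]], Eq as [-> | [-> | ->]], Er as [-> | [-> | ->]];
    try reflexivity; exfalso; apply H; unfold trichromatic; lia.
Qed.

(* Each column of the grid carries the parity of its {1,2}-edges.  A strip
   without trichromatic triangle transports this parity to the next column;
   it is even on the left side and odd on the right side. *)
Lemma sperner_grid (n : nat) (L : nat -> nat -> nat) :
  (forall i j, (L i j <= 2)%nat) ->
  (forall j, (j <= n)%nat -> L 0%nat j = 0%nat) ->
  (forall j, (j <= n)%nat -> L n j <> 0%nat) ->
  (forall i, (i <= n)%nat -> L i 0%nat <> 2%nat) ->
  (forall i, (i <= n)%nat -> L i n <> 1%nat) ->
  exists i j, (i < n)%nat /\ (j < n)%nat /\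
    (trichromatic (L i j) (L (S i) j) (L (S i) (S j)) \/
     trichromatic (L i j) (L i (S j)) (L (S i) (S j))).
Proof.
  intros H2 Hl Hr Hb Ht. apply NNPP; intros Hno.
  set (V := fun i => xorsum n (fun j => edge12 (L i j) (L i (S j)))).
  assert (Hstep : forall i, (i < n)%nat -> V (S i) = V i).
  { intros i Hi.
    (* Adding up modulo 2 the triangles of the strip below height [m] cancels the diagonals and the
       inner horizontal edges. What remains is the two columns and the horizontal edges at heights 0
       and [m]. *)
    assert (Hpart : forall m, (m <= n)%nat ->
      xorb (xorsum m (fun j => edge12 (L i j) (L i (S j))))
           (xorsum m (fun j => edge12 (L (S i) j) (L (S i) (S j))))
      = xorb (edge12 (L i 0%nat) (L (S i) 0%nat)) (edge12 (L i m) (L (S i) m))).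
    { induction m as [|m IH]; intros Hm; cbn [xorsum].
      - destruct (edge12 _ _); reflexivity.
      - specialize (IH ltac:(lia)).
        assert (T1 : ~ trichromatic (L i m) (L (S i) m) (L (S i) (S m)))
          by (intros T; apply Hno; exists i, m; repeat split; auto; lia).
        assert (T2 : ~ trichromatic (L i m) (L i (S m)) (L (S i) (S m)))
          by (intros T; apply Hno; exists i, m; repeat split; auto; lia).
        apply not_trichromatic_edges in T1; auto.
        apply not_trichromatic_edges in T2; auto.
        revert IH T1 T2.
        generalize (xorsum m (fun j => edge12 (L i j) (L i (S j))))
          (xorsum m (fun j => edge12 (L (S i) j) (L (S i) (S j))))
          (edge12 (L i 0%nat) (L (S i) 0%nat)) (edge12 (L i m) (L (S i) m))
          (edge12 (L i m) (L i (S m))) (edge12 (L (S i) m) (L (S i) (S m)))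
          (edge12 (L i (S m)) (L (S i) (S m))) (edge12 (L i m) (L (S i) (S m))).
        intros [] [] [] [] [] [] [] []; simpl; congruence. }
    specialize (Hpart n (Nat.le_refl n)).
    (* The label 2 is absent from the bottom side and the label 1 from the top side, so neither
       carries a {1,2}-edge. *)
    replace (edge12 (L i 0%nat) (L (S i) 0%nat)) with false in Hpart.
    2: { assert (A1 := Hb i ltac:(lia)). assert (A2 := Hb (S i) ltac:(lia)).
         unfold edge12; destruct (Nat.eqb_spec (L i 0%nat) 2), (Nat.eqb_spec (L (S i) 0%nat) 2); lia. }
    replace (edge12 (L i n) (L (S i) n)) with false in Hpart.
    2: { assert (A1 := Ht i ltac:(lia)). assert (A2 := Ht (S i) ltac:(lia)).
         unfold edge12; destruct (Nat.eqb_spec (L i n) 1), (Nat.eqb_spec (L (S i) n) 1); lia. }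
    fold (V i) in Hpart; fold (V (S i)) in Hpart.
    destruct (V i), (V (S i)); simpl in Hpart; congruence. }
  assert (Hconst : forall i, (i <= n)%nat -> V i = V 0%nat).
  { induction i as [|i IH]; intros Hi; [reflexivity|].
    rewrite Hstep, IH; [reflexivity|lia|lia]. }
  assert (H0 : V 0%nat = false).
  { unfold V. assert (Hm : forall m, (m <= n)%nat ->
      xorsum m (fun j => edge12 (L 0%nat j) (L 0%nat (S j))) = false).
    { induction m as [|m IH]; intros Hm; simpl; [reflexivity|].
      rewrite IH, Hl, Hl by lia; reflexivity. }
    apply Hm; lia. }
  (* The right side uses only the labels 1 and 2 and starts with 1, so the parity of the number of
     changes tells whether the current label is 2. At the top corner, where 1 is forbidden, it is
     odd. *)
  assert (Hn : forall m, (m <= n)%nat ->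
    xorsum m (fun j => edge12 (L n j) (L n (S j))) = Nat.eqb (L n m) 2).
  { induction m as [|m IH]; intros Hm; cbn [xorsum].
    - symmetry; apply Nat.eqb_neq, Hb; lia.
    - rewrite IH by lia.
      assert (A1 := Hr m ltac:(lia)). assert (A2 := Hr (S m) ltac:(lia)).
      assert (B1 := H2 n m). assert (B2 := H2 n (S m)).
      assert (C1 : (L n m = 1 \/ L n m = 2)%nat) by lia.
      assert (C2 : (L n (S m) = 1 \/ L n (S m) = 2)%nat) by lia.
      destruct C1 as [-> | ->], C2 as [-> | ->]; reflexivity. }
  specialize (Hn n (Nat.le_refl n)). fold (V n) in Hn.
  rewrite Hconst, H0 in Hn by lia.
  assert (A1 := Hr n ltac:(lia)). assert (A2 := Ht n ltac:(lia)). assert (A3 := H2 n n).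
  symmetry in Hn; apply Nat.eqb_neq in Hn; lia.
Qed.

Definition square : space :=
  fun z => in_Rd 2 z /\ Rabs (z 0%nat) <= 1 /\ Rabs (z 1%nat) <= 1.

Lemma square_compact : seq_compact 2 square.
Proof.
  apply (closed_bounded_compact 2 square 1).
  - intros x Hx; apply Hx.
  - intros x [|[|i]] (Hin & H0 & H1); auto.
    rewrite Hin, Rabs_R0 by lia; lra.
  - intros l Hin Hl; split; [exact Hin|]; split.
    + apply (closed_le 2 square (fun x => Rabs (x 0%nat))); auto.
      * apply rcont_abs, rcont_coord; lia.
      * intros x Hx; apply Hx.
    + apply (closed_le 2 square (fun x => Rabs (x 1%nat))); auto.
      * apply rcont_abs, rcont_coord; lia.
      * intros x Hx; apply Hx.
Qed.

Definition pt2 (s t : R) : nat -> R :=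
  fun i => match i with O => s | 1%nat => t | _ => 0 end.

Lemma pt2_in s t : in_Rd 2 (pt2 s t).
Proof. intros [|[|i]] H; try lia; reflexivity. Qed.

Lemma pt2_eta z : in_Rd 2 z -> pt2 (z 0%nat) (z 1%nat) = z.
Proof.
  intros H; apply (in_Rd_ext 2); [apply pt2_in|exact H|].
  intros [|[|i]] Hi; try lia; reflexivity.
Qed.

(** In the plane [dist_lt_of_coords] asks for e / 3 in each coordinate, here shared equally by two
    displacements. *)
Lemma square_near_dist l s t s' t' e :
  Rabs (s' - s) <= e / 6 -> Rabs (t' - t) <= e / 6 -> dist 2 l (pt2 s t) < e / 6 ->
  dist 2 l (pt2 s' t') < e.
Proof.
  intros Hs Ht Hd.
  assert (H0 := coord_le_dist 2 l (pt2 s t) 0 ltac:(lia)).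
  assert (H1 := coord_le_dist 2 l (pt2 s t) 1 ltac:(lia)). simpl in H0, H1.
  assert (Hpos : 0 < e) by (assert (0 <= dist 2 l (pt2 s t)) by apply sqrt_pos; lra).
  apply dist_lt_of_coords; [exact Hpos|].
  intros i Hi; replace (e / (INR 2 + 1)) with (e / 3) by (simpl; field).
  destruct i as [|[|i]]; [| |lia]; simpl;
    repeat match goal with H : Rabs _ <= _ |- _ => apply Rabs_le_between in H end;
    apply Rabs_le_between; lra.
Qed.

Section PoincareMiranda.

Variables f g : (nat -> R) -> R.
Hypothesis Hf : rcont 2 square f.
Hypothesis Hg : rcont 2 square g.
Hypothesis Hleft : forall z, square z -> z 0%nat = -1 -> f z < 0.
Hypothesis Hright : forall z, square z -> z 0%nat = 1 -> 0 < f z.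
Hypothesis Hbottom : forall z, square z -> z 1%nat = -1 -> g z < 0.
Hypothesis Htop : forall z, square z -> z 1%nat = 1 -> 0 < g z.

(** The sign conditions on the four sides become the boundary conditions of [sperner_grid]: always 0
    on the left, never 0 on the right, never 2 at the bottom, never 1 at the top. *)
Definition label (z : nat -> R) : nat :=
  if Rlt_dec (f z) 0 then 0%nat else if Rlt_dec (g z) 0 then 1%nat else 2%nat.

Lemma small_trichromatic (n : nat) : (0 < n)%nat ->
  exists s t, square (pt2 s t) /\
    forall c, (c <= 2)%nat -> exists s' t', square (pt2 s' t') /\ label (pt2 s' t') = c /\
      Rabs (s' - s) <= 2 / INR n /\ Rabs (t' - t) <= 2 / INR n.
Proof.
  intros Hn. assert (HN : 0 < INR n) by (apply lt_0_INR, Hn).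
  assert (Hinv : 0 < / INR n) by (apply Rinv_0_lt_compat, HN).
  assert (Hmul : INR n * / INR n = 1) by (field; lra).
  (* Subdivision of [-1, 1] into [n] intervals of length 2 / n. *)
  set (x := fun i : nat => 2 * INR i * / INR n - 1).
  assert (Hx0 : x 0%nat = -1) by (unfold x; simpl; ring).
  assert (Hxn : x n = 1) by (unfold x; nra).
  assert (HxS : forall i, x (S i) - x i = 2 / INR n)
    by (intros i; unfold x; rewrite S_INR; field; lra).
  assert (Hx : forall i, (i <= n)%nat -> Rabs (x i) <= 1).
  { intros i Hi; apply le_INR in Hi. assert (0 <= INR i) by apply pos_INR.
    apply Rabs_le_between; unfold x; split; nra. }
  assert (Hsq : forall i j, (i <= n)%nat -> (j <= n)%nat -> square (pt2 (x i) (x j))).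
  { intros i j Hi Hj; split; [apply pt2_in|split; simpl; auto]. }
  destruct (sperner_grid n (fun i j => label (pt2 (x i) (x j)))) as (i & j & Hi & Hj & T).
  - intros i j; unfold label; destruct (Rlt_dec _ _); [lia|]; destruct (Rlt_dec _ _); lia.
  - intros j Hj; unfold label. destruct (Rlt_dec _ _) as [_|Hc]; [reflexivity|].
    elim Hc; apply Hleft; [apply Hsq; lia|exact Hx0].
  - intros j Hj; unfold label. destruct (Rlt_dec _ _) as [Hc|_].
    + assert (H := Hright _ (Hsq n j ltac:(lia) Hj) Hxn); lra.
    + destruct (Rlt_dec _ _); lia.
  - intros j Hj; unfold label. destruct (Rlt_dec _ _) as [_|_]; [lia|].
    destruct (Rlt_dec _ _) as [_|Hc]; [lia|].
    elim Hc; apply Hbottom; [apply Hsq; lia|exact Hx0].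
  - intros j Hj; unfold label. destruct (Rlt_dec _ _) as [_|_]; [lia|].
    destruct (Rlt_dec _ _) as [Hc|_]; [|lia].
    assert (H := Htop _ (Hsq j n Hj ltac:(lia)) Hxn); lra.
  - assert (H2n : 0 <= 2 / INR n) by (unfold Rdiv; lra).
    assert (D0 : forall i, Rabs (x i - x i) <= 2 / INR n)
      by (intros k; rewrite Rminus_diag, Rabs_R0; exact H2n).
    assert (D1 : forall i, Rabs (x (S i) - x i) <= 2 / INR n)
      by (intros k; rewrite HxS, Rabs_pos_eq; [lra|exact H2n]).
    exists (x i), (x j); split; [apply Hsq; lia|]; intros c Hc.
    assert (Hpick : forall i' j', (i' = i \/ i' = S i) -> (j' = j \/ j' = S j) ->
      label (pt2 (x i') (x j')) = c ->
      exists s' t', square (pt2 s' t') /\ label (pt2 s' t') = c /\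
        Rabs (s' - x i) <= 2 / INR n /\ Rabs (t' - x j) <= 2 / INR n).
    { intros i' j' Hi' Hj' E; exists (x i'), (x j'); split; [apply Hsq; lia|].
      split; [exact E|]; destruct Hi' as [-> | ->], Hj' as [-> | ->]; auto. }
    assert (Ec : (c = 0 \/ c = 1 \/ c = 2)%nat) by lia.
    destruct T as [(T0 & T1 & T2)|(T0 & T1 & T2)];
      destruct Ec as [-> | [-> | ->]];
      match goal with
      | H : _ = ?c \/ _ = ?c \/ _ = ?c |- exists s t, _ /\ _ = ?c /\ _ =>
          destruct H as [E|[E|E]]
      end; revert E; apply Hpick; auto.
Qed.

(** The trichromatic triangles of finer and finer grids cluster at some [l], so all three labels
    occur in every neighbourhood of [l]. *)
Lemma poincare_miranda : exists z, square z /\ f z = 0 /\ g z = 0.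
Proof.
  assert (H : forall n : nat, exists z, square z /\
    forall c, (c <= 2)%nat -> exists s' t', square (pt2 s' t') /\ label (pt2 s' t') = c /\
      Rabs (s' - z 0%nat) <= 2 / INR (S n) /\ Rabs (t' - z 1%nat) <= 2 / INR (S n)).
  { intros n; destruct (small_trichromatic (S n)) as (s & t & Hsq & Hc); [lia|].
    exists (pt2 s t); auto. }
  destruct (choice _ H) as [u Hu].
  destruct (square_compact u) as (l & Hl & Hcl); [apply Hu|].
  assert (Hnear : forall c P, (c <= 2)%nat -> near 2 square l P ->
    exists z, P z /\ label z = c).
  { intros c P Hc (e & He & HP).
    assert (He6 : 0 < e / 12) by lra.
    destruct (archimed_cor1 _ He6) as (n0 & Hn0 & Hpos).
    destruct (Hcl (e / 6) ltac:(lra) n0) as (m & Hm & Hd).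
    destruct (proj2 (Hu m) c Hc) as (s & t & Hsq & Hlab & Hs & Ht).
    assert (Hm' : 2 / INR (S m) <= e / 6).
    { assert (0 < INR n0) by (apply lt_0_INR; exact Hpos).
      assert (INR n0 <= INR (S m)) by (apply le_INR; lia).
      assert (/ INR (S m) <= / INR n0) by (apply Rinv_le_contravar; lra).
      unfold Rdiv; lra. }
    exists (pt2 s t); split; [|exact Hlab]. apply HP; [exact Hsq|].
    apply (square_near_dist l (u m 0%nat) (u m 1%nat)); try lra.
    rewrite pt2_eta; [exact Hd|apply Hu]. }
  (* Near [l], a positive [f l] would exclude the label 0 and a negative one the label 1; a positive
     [g l] would exclude the label 1 and a negative one the label 2. *)
  exists l; split; [exact Hl|]; split; apply Rle_antisym; apply Rnot_lt_le; intros Hc.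
  - destruct (Hnear 0%nat _ ltac:(lia) (rcont_eps 2 square f l (f l) Hf Hl Hc)) as (z & Hz & E).
    apply Rabs_lt_between in Hz. revert E; unfold label.
    destruct (Rlt_dec _ _); [lra|]; destruct (Rlt_dec _ _); discriminate.
  - destruct (Hnear 1%nat _ ltac:(lia) (rcont_eps 2 square f l (- f l) Hf Hl ltac:(lra)))
      as (z & Hz & E).
    apply Rabs_lt_between in Hz. revert E; unfold label.
    destruct (Rlt_dec _ _); [discriminate|lra].
  - destruct (Hnear 1%nat _ ltac:(lia) (rcont_eps 2 square g l (g l) Hg Hl Hc)) as (z & Hz & E).
    apply Rabs_lt_between in Hz. revert E; unfold label.
    destruct (Rlt_dec _ _); [discriminate|]; destruct (Rlt_dec _ _); [lra|discriminate].
  - destruct (Hnear 2%nat _ ltac:(lia) (rcont_eps 2 square g l (- g l) Hg Hl ltac:(lra)))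
      as (z & Hz & E).
    apply Rabs_lt_between in Hz. revert E; unfold label.
    destruct (Rlt_dec _ _); [discriminate|]; destruct (Rlt_dec _ _); [discriminate|lra].
Qed.

End PoincareMiranda.

(** * Edges whose star is not a disc *)

Definition supported (d a b c : nat) : space :=
  fun x => in_Rd d x /\ (forall i, 0 <= x i) /\ rsum d x = 1 /\
    forall i, x i <> 0 -> i = a \/ i = b \/ i = c.

Definition bary (a b c : nat) (u v w : R) : nat -> R :=
  fun i => u * delta a i + v * delta b i + w * delta c i.

Lemma bary_supported d a b c u v w :
  (a < d)%nat -> (b < d)%nat -> (c < d)%nat ->
  0 <= u -> 0 <= v -> 0 <= w -> u + v + w = 1 -> supported d a b c (bary a b c u v w).
Proof.
  intros Ha Hb Hc Hu Hv Hw Hs; unfold bary; repeat split.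
  - intros i Hi; rewrite !delta_diff by lia; ring.
  - intros i; unfold delta; destruct (Nat.eqb i a), (Nat.eqb i b), (Nat.eqb i c); lra.
  - rewrite !rsum_plus, !rsum_scal, !rsum_delta; auto; lra.
  - intros i Hi; unfold delta in Hi.
    destruct (Nat.eqb_spec i a), (Nat.eqb_spec i b), (Nat.eqb_spec i c); auto.
    elim Hi; ring.
Qed.

Lemma supported_bary d a b c x :
  a <> b -> a <> c -> b <> c -> supported d a b c x -> x = bary a b c (x a) (x b) (x c).
Proof.
  intros Hab Hac Hbc (_ & _ & _ & H); apply functional_extensionality; intros i; unfold bary, delta.
  destruct (Nat.eqb_spec i a), (Nat.eqb_spec i b), (Nat.eqb_spec i c);
    try congruence; try (subst i; lra).
  destruct (Req_dec (x i) 0) as [->|Hx]; [lra|]. destruct (H i Hx) as [|[|]]; congruence.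
Qed.

Lemma supported_sum d a b c x :
  (a < d)%nat -> (b < d)%nat -> (c < d)%nat ->
  a <> b -> a <> c -> b <> c -> supported d a b c x -> x a + x b + x c = 1.
Proof.
  intros Ha Hb Hc Hab Hac Hbc H.
  assert (E := supported_bary d a b c x Hab Hac Hbc H).
  destruct H as (_ & _ & Hs & _). rewrite E in Hs. unfold bary in Hs.
  rewrite !rsum_plus, !rsum_scal, !rsum_delta in Hs; auto; lra.
Qed.

Lemma bary_at_1 a b c u v w : a <> b -> a <> c -> bary a b c u v w a = u.
Proof. intros; unfold bary; rewrite delta_same, !delta_diff; auto; ring. Qed.
Lemma bary_at_2 a b c u v w : a <> b -> b <> c -> bary a b c u v w b = v.
Proof. intros; unfold bary; rewrite delta_same, !delta_diff; auto; ring. Qed.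
Lemma bary_at_3 a b c u v w : a <> c -> b <> c -> bary a b c u v w c = w.
Proof. intros; unfold bary; rewrite delta_same, !delta_diff; auto; ring. Qed.

(** The third vertex has weight 0; filling its place with [a] makes the point visibly the same on
    every triangle containing the edge. *)
Definition midpoint (a b : nat) : nat -> R := bary a b a (1 / 2) (1 / 2) 0.

Lemma midpoint_bary a b c : midpoint a b = bary a b c (1 / 2) (1 / 2) 0.
Proof. apply functional_extensionality; intros i; unfold midpoint, bary; ring. Qed.

(** The maximum norm, equal to 1 exactly on the boundary of [square]. *)
Definition zmax (z : nat -> R) : R := Rmax (Rabs (z 0%nat)) (Rabs (z 1%nat)).

Lemma zmax_le z : square z -> 0 <= zmax z <= 1.
Proof.
  intros (_ & H0 & H1); split; [|apply Rmax_lub; assumption].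
  eapply Rle_trans; [apply Rabs_pos|apply Rmax_l].
Qed.

Lemma zmax_boundary z i : square z -> (i < 2)%nat -> Rabs (z i) = 1 -> zmax z = 1.
Proof.
  intros (_ & H0 & H1) Hi E; unfold zmax.
  destruct i as [|[|i]]; [| |lia].
  - rewrite E; apply Rmax_left; assumption.
  - rewrite E; apply Rmax_right; assumption.
Qed.

Lemma rcont_zmax : rcont 2 square zmax.
Proof. apply rcont_max; apply rcont_abs, rcont_coord; lia. Qed.

(** On each side of the square one component of [F - q] is constantly [r] or [- r], with the sign
    that [poincare_miranda] asks for. *)
Lemma no_retraction (F : (nat -> R) -> (nat -> R)) (q : nat -> R) r :
  0 < r ->
  (forall i, (i < 2)%nat -> rcont 2 square (fun z => F z i)) ->
  (forall z, square z -> zmax z = 1 -> forall i, (i < 2)%nat -> F z i = q i + r * z i) ->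
  exists z, square z /\ forall i, (i < 2)%nat -> F z i = q i.
Proof.
  intros Hr HF HB.
  assert (A1 : Rabs (-1) = 1) by (rewrite Rabs_left; lra).
  assert (A2 : Rabs 1 = 1) by (rewrite Rabs_pos_eq; lra).
  destruct (poincare_miranda (fun z => F z 0%nat - q 0%nat) (fun z => F z 1%nat - q 1%nat))
    as (z & Hz & E0 & E1).
  - apply rcont_minus; [apply HF; lia|apply rcont_const].
  - apply rcont_minus; [apply HF; lia|apply rcont_const].
  - intros z Hz E; rewrite HB; [rewrite E; lra|exact Hz| |lia].
    apply (zmax_boundary z 0); [exact Hz|lia|rewrite E; exact A1].
  - intros z Hz E; rewrite HB; [rewrite E; lra|exact Hz| |lia].
    apply (zmax_boundary z 0); [exact Hz|lia|rewrite E; exact A2].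
  - intros z Hz E; rewrite HB; [rewrite E; lra|exact Hz| |lia].
    apply (zmax_boundary z 1); [exact Hz|lia|rewrite E; exact A1].
  - intros z Hz E; rewrite HB; [rewrite E; lra|exact Hz| |lia].
    apply (zmax_boundary z 1); [exact Hz|lia|rewrite E; exact A2].
  - exists z; split; [exact Hz|]. intros [|[|i]] Hi; try lia; lra.
Qed.

(* The push-off [(1 - l) g + l c0], with [l] vanishing exactly on the boundary of the
   square, moves a loop around [q] off the boundary of the half-disc, hence off [p]. *)
Lemma free_edge_not_surface d (A : space) a b c :
  (a < d)%nat -> (b < d)%nat -> (c < d)%nat -> a <> b -> a <> c -> b <> c ->
  (forall x, supported d a b c x -> A x) ->
  (forall x, A x -> 0 < x a -> 0 < x b -> supported d a b c x) ->
  ~ is_surface d A.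
Proof.
  intros Ha Hb Hc Hab Hac Hbc Hface Hstar [HAin HA].
  set (p := midpoint a b).
  assert (Ep : p = bary a b c (1 / 2) (1 / 2) 0) by apply midpoint_bary.
  assert (HAp : A p) by (rewrite Ep; apply Hface, bary_supported; auto; lra).
  assert (Hpa : p a = 1 / 2) by (rewrite Ep; apply bary_at_1; auto).
  assert (Hpb : p b = 1 / 2) by (rewrite Ep; apply bary_at_2; auto).
  assert (Hpc : p c = 0) by (rewrite Ep; apply bary_at_3; auto).
  destruct (HA p HAp) as (U & V & HUp & [HUA HUo] & [HVin HVo] &
    f & g & HfV & HgU & Hgf & Hfg & Hfc & Hgc).
  destruct (HUo p HUp) as (r & Hr & HrU).
  set (q := f p). assert (HVq : V q) by (apply HfV, HUp).
  assert (Hgq : g q = p) by (apply Hgf, HUp).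
  assert (Hd0 := pos_INR d).
  (* The bound 1/4 keeps the weights of [a] and [b] positive, so that points within [eta] of [p] lie
     in the triangle; the other bound keeps them in [U]. *)
  set (eta := Rmin (1 / 4) (r / (INR d + 1))).
  assert (Heta : 0 < eta) by (apply Rmin_glb_lt; [lra|apply Rdiv_lt_0_compat; lra]).
  assert (Heta1 : eta <= 1 / 4) by apply Rmin_l.
  assert (Heta2 : eta <= r / (INR d + 1)) by apply Rmin_r.
  destruct (HVo q HVq) as (R0 & HR0 & HR0V).
  destruct (Hgc q HVq eta Heta) as (R1 & HR1 & HR1g). rewrite Hgq in HR1g.
  (* The divisor 3 is [INR 2 + 1] from [dist_lt_of_coords]. *)
  set (rho := Rmin R0 R1 / 3).
  assert (Hmin : 0 < Rmin R0 R1) by (apply Rmin_glb_lt; assumption).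
  assert (Hrho : 0 < rho) by (unfold rho; lra).
  set (emb := fun (z : nat -> R) i => q i + rho * z i).
  assert (Hemb_in : forall z, square z -> in_Rd 2 (emb z)).
  { intros z [Hz _] i Hi; unfold emb; rewrite (HVin q HVq i Hi), (Hz i Hi); ring. }
  assert (Hemb_d : forall z, square z -> dist 2 q (emb z) < Rmin R0 R1).
  { intros z (_ & H0 & H1); apply dist_lt_of_coords; [exact Hmin|]; intros i Hi.
    replace (Rmin R0 R1 / (INR 2 + 1)) with rho by (unfold rho; simpl; field).
    unfold emb; replace (q i - (q i + rho * z i)) with (- (rho * z i)) by ring.
    rewrite Rabs_Ropp, Rabs_mult, (Rabs_pos_eq rho) by lra.
    destruct i as [|[|i]]; [nra|nra|lia]. }
  assert (HembV : forall z, square z -> V (emb z)).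
  { intros z Hz; apply HR0V; [apply Hemb_in, Hz|].
    eapply Rlt_le_trans; [apply Hemb_d, Hz|apply Rmin_l]. }
  assert (Hg_near : forall z, square z -> forall i, (i < d)%nat -> Rabs (p i - g (emb z) i) < eta).
  { intros z Hz i Hi. eapply Rle_lt_trans; [apply coord_le_dist, Hi|].
    apply HR1g; [apply HembV, Hz|]. eapply Rlt_le_trans; [apply Hemb_d, Hz|apply Rmin_r]. }
  assert (Hg_sup : forall z, square z -> supported d a b c (g (emb z))).
  { intros z Hz; apply Hstar; [apply HUA, HgU, HembV, Hz| |].
    - assert (H := Hg_near z Hz a Ha); apply Rabs_lt_between in H; lra.
    - assert (H := Hg_near z Hz b Hb); apply Rabs_lt_between in H; lra. }
  set (c0 := bary a b c (1 / 2 - eta / 2) (1 / 2 - eta / 2) eta).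
  assert (Hc0 : supported d a b c c0) by (apply bary_supported; auto; lra).
  assert (Hc0c : c0 c = eta) by (apply bary_at_3; auto).
  assert (Hc0_near : forall i, Rabs (p i - c0 i) <= eta).
  { intros i; rewrite Ep; unfold c0, bary, delta; apply Rabs_le_between.
    destruct (Nat.eqb_spec i a), (Nat.eqb_spec i b), (Nat.eqb_spec i c);
      try congruence; split; lra. }
  set (psi := fun z i => zmax z * g (emb z) i + (1 - zmax z) * c0 i).
  assert (Hpsi_sup : forall z, square z -> supported d a b c (psi z)).
  { intros z Hz; destruct (Hg_sup z Hz) as (I1 & P1 & S1 & T1), Hc0 as (I2 & P2 & S2 & T2).
    destruct (zmax_le z Hz). unfold psi; repeat split.
    - intros i Hi; rewrite I1, I2 by exact Hi; ring.
    - intros i; specialize (P1 i); specialize (P2 i); nra.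
    - rewrite rsum_plus, !rsum_scal, S1, S2; ring.
    - intros i Hi. destruct (Req_dec (g (emb z) i) 0) as [E1|]; [|auto].
      destruct (Req_dec (c0 i) 0) as [E2|]; [|auto].
      elim Hi; rewrite E1, E2; ring. }
  assert (HpsiU : forall z, square z -> U (psi z)).
  { intros z Hz; apply HrU; [apply Hface, Hpsi_sup, Hz|].
    apply dist_lt_of_coords; [exact Hr|]; intros i Hi.
    apply Rle_trans with eta; [|exact Heta2].
    assert (H1 := Hg_near z Hz i Hi). assert (H2 := Hc0_near i).
    destruct (zmax_le z Hz). unfold psi.
    apply Rabs_lt_between in H1. apply Rabs_le_between in H2. apply Rabs_le_between.
    split; nra. }
  assert (Hembc : continuous_on 2 2 square emb).
  { apply continuous_on_coords; intros i Hi; unfold emb.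
    apply rcont_plus; [apply rcont_const|].
    apply rcont_mult; [apply rcont_const|apply rcont_coord, Hi]. }
  assert (Hpsic : continuous_on 2 d square psi).
  { apply continuous_on_coords; intros i Hi; unfold psi.
    apply rcont_plus; apply rcont_mult.
    - apply rcont_zmax.
    - apply (rcont_comp_map 2 2 square V emb (fun y => g y i)); auto.
      apply (rcont_of_continuous_on 2 d); auto.
    - apply rcont_minus; [apply rcont_const|apply rcont_zmax].
    - apply rcont_const. }
  destruct (no_retraction (fun z => f (psi z)) q rho Hrho) as (z & Hz & Ez).
  - intros i Hi. apply (rcont_comp_map 2 d square U psi (fun y => f y i)); auto.
    apply (rcont_of_continuous_on d 2); auto.
  - intros z Hz E i Hi.
    replace (psi z) with (g (emb z)).
    + rewrite Hfg by (apply HembV, Hz); reflexivity.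
    + apply functional_extensionality; intros k; unfold psi; rewrite E; ring.
  - assert (Efq : f (psi z) = q).
    { apply (in_Rd_ext 2); auto. }
    assert (Epsi : psi z = p) by (rewrite <- (Hgf (psi z)), Efq; auto).
    (* The weight of [psi z] at [c] is at least [(1 - zmax z) * eta], and that of [p] is 0; so [z]
       is on the boundary. There [psi z] is [g (emb z)], whence [emb z = q] and [z = 0], which is
       absurd. *)
    assert (Hzm : zmax z = 1).
    { destruct (zmax_le z Hz).
      assert (E : psi z c = 0) by (rewrite Epsi; exact Hpc).
      unfold psi in E; rewrite Hc0c in E.
      destruct (Hg_sup z Hz) as (_ & P1 & _). specialize (P1 c). nra. }
    assert (Eg : g (emb z) = p).
    { rewrite <- Epsi; apply functional_extensionality; intros k; unfold psi; rewrite Hzm; ring. }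
    assert (Eemb : emb z = q).
    { rewrite <- (Hfg (emb z)) by (apply HembV, Hz). rewrite Eg; reflexivity. }
    assert (Hz0 : forall i, z i = 0).
    { intros i; assert (E := f_equal (fun x => x i) Eemb); unfold emb in E; simpl in E. nra. }
    unfold zmax in Hzm; rewrite !Hz0, Rabs_R0, Rmax_left in Hzm; lra.
Qed.

(* The pages [c] and [d] form a disc around [p], whose image misses the points
   [q' = f p'] with [p'] on the third page.  Translating the image by [q - q'], and by
   less and less near its boundary, makes it miss [q]; folding the other pages onto [c]
   then yields a retraction of that disc onto its boundary. *)
Lemma three_pages_not_surface n (A : space) a b c d e :
  (a < n)%nat -> (b < n)%nat -> (c < n)%nat -> (d < n)%nat -> (e < n)%nat ->
  NoDup [a; b; c; d; e] ->
  (forall x, supported n a b c x -> A x) ->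
  (forall x, supported n a b d x -> A x) ->
  (forall x, supported n a b e x -> A x) ->
  (forall x, A x -> 0 < x a -> 0 < x b ->
     exists w, (w < n)%nat /\ w <> a /\ w <> b /\ supported n a b w x) ->
  ~ is_surface n A.
Proof.
  intros Ha Hb Hc Hd He Hnd Hfc Hfd Hfe Hstar [HAin HA].
  assert (Hne : a <> b /\ a <> c /\ a <> d /\ a <> e /\ b <> c /\ b <> d /\ b <> e /\
                c <> d /\ c <> e /\ d <> e).
  { repeat match goal with H : NoDup (_ :: _) |- _ => inversion H; clear H; subst end.
    simpl in *. intuition congruence. }
  destruct Hne as (Hab & Hac & Had & Hae & Hbc & Hbd & Hbe & Hcd & Hce & Hde).
  set (p := midpoint a b).
  assert (Ep : forall k, p = bary a b k (1 / 2) (1 / 2) 0) by (intros; apply midpoint_bary).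
  assert (HAp : A p) by (rewrite (Ep c); apply Hfc, bary_supported; auto; lra).
  assert (Hpa : p a = 1 / 2) by (rewrite (Ep c); apply bary_at_1; auto).
  assert (Hpb : p b = 1 / 2) by (rewrite (Ep c); apply bary_at_2; auto).
  assert (Hpc : p c = 0) by (rewrite (Ep c); apply bary_at_3; auto).
  assert (Hpd : p d = 0) by (rewrite (Ep d); apply bary_at_3; auto).
  destruct (HA p HAp) as (U & V & HUp & [HUA HUo] & [HVin HVo] &
    f & g & HfV & HgU & Hgf & Hfg & Hfcont & Hgcont).
  destruct (HUo p HUp) as (r & Hr & HrU).
  set (q := f p). assert (HVq : V q) by (apply HfV, HUp).
  assert (Hgq : g q = p) by (apply Hgf, HUp).
  assert (Hn0 := pos_INR n).
  assert (Hball : forall t, 0 < t -> exists t', 0 < t' /\ forall y, in_Rd 2 y ->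
    (forall i, (i < 2)%nat -> Rabs (y i - q i) < t') -> V y /\ dist n p (g y) < t).
  { intros t Ht. destruct (HVo q HVq) as (R0 & HR0 & HR0V).
    destruct (Hgcont q HVq t Ht) as (R1 & HR1 & HR1g). rewrite Hgq in HR1g.
    assert (Hmin : 0 < Rmin R0 R1) by (apply Rmin_glb_lt; assumption).
    exists (Rmin R0 R1 / 3); split; [lra|]; intros y Hy Hyq.
    assert (Hdist : dist 2 q y < Rmin R0 R1).
    { apply dist_lt_of_coords; [exact Hmin|]; intros i Hi.
      replace (Rmin R0 R1 / (INR 2 + 1)) with (Rmin R0 R1 / 3) by (simpl; field).
      rewrite Rabs_minus_sym; left; apply Hyq, Hi. }
    assert (HVy : V y)
      by (apply HR0V; [exact Hy|]; eapply Rlt_le_trans; [exact Hdist|apply Rmin_l]).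
    split; [exact HVy|]. apply HR1g; [exact HVy|].
    eapply Rlt_le_trans; [exact Hdist|apply Rmin_r]. }
  assert (Hfball : forall t, 0 < t -> exists t', 0 < t' <= 1 / 4 /\ forall x, A x ->
    (forall i, Rabs (x i - p i) <= t') ->
    U x /\ forall i, (i < 2)%nat -> Rabs (f x i - q i) < t).
  { intros t Ht. destruct (Hfcont p HUp t Ht) as (R1 & HR1 & HR1f). fold q in HR1f.
    set (s := Rmin r R1). assert (Hs : 0 < s) by (apply Rmin_glb_lt; assumption).
    assert (Hs' : 0 < s / (INR n + 1)) by (apply Rdiv_lt_0_compat; lra).
    exists (Rmin (1 / 4) (s / (INR n + 1))); split.
    - split; [apply Rmin_glb_lt; lra|apply Rmin_l].
    - intros x Hx Hxp.
      assert (Hdist : dist n p x < s).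
      { apply dist_lt_of_coords; [exact Hs|]; intros i Hi; rewrite Rabs_minus_sym.
        eapply Rle_trans; [apply Hxp|apply Rmin_r]. }
      assert (HUx : U x)
        by (apply HrU; [exact Hx|]; eapply Rlt_le_trans; [exact Hdist|apply Rmin_l]).
      split; [exact HUx|]; intros i Hi; rewrite Rabs_minus_sym.
      eapply Rle_lt_trans; [apply coord_le_dist, Hi|]. apply HR1f; [exact HUx|].
      eapply Rlt_le_trans; [exact Hdist|apply Rmin_r]. }
  (* Within [R1] of [q], the map [g] stays so close to [p] that the weights of [a] and [b] are
     positive. The disc of size [sg] is sent within [R1 / 2] of [q], which leaves room for a
     translation by less than [R1 / 2]. A point of its image within [m] of [q] comes from within
     [sg / 4] of [p], hence from the inner half of the square. Finally [tau] places [q'] within both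
     [m] and [R1 / 2] of [q]. *)
  destruct (Hball (1 / 2) ltac:(lra)) as (R1 & HR1 & HR1V).
  destruct (Hfball (R1 / 2) ltac:(lra)) as (sg & [Hsg Hsg4] & Hsgf).
  destruct (Hball (sg / 4) ltac:(lra)) as (m & Hm & HmV).
  destruct (Hfball (Rmin m (R1 / 2))) as (tau & [Htau Htau4] & Htauf);
    [apply Rmin_glb_lt; lra|].
  set (p' := bary a b e (1 / 2 - tau / 2) (1 / 2 - tau / 2) tau).
  assert (HAp' : A p') by (apply Hfe, bary_supported; auto; lra).
  assert (Hp'e : p' e = tau) by (apply bary_at_3; auto).
  destruct (Htauf p' HAp') as [HUp' Hq'].
  { intros i; rewrite (Ep e); unfold p', bary, delta; apply Rabs_le_between.
    destruct (Nat.eqb_spec i a), (Nat.eqb_spec i b), (Nat.eqb_spec i e);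
      try congruence; split; lra. }
  set (q' := f p') in *.
  assert (Hmin1 := Rmin_l m (R1 / 2)). assert (Hmin2 := Rmin_r m (R1 / 2)).
  (* The disc made of the pages [c] (where [z 1 >= 0]) and [d] (where [z 1 <= 0]): [sg * z 0] is the
     difference of the weights at [a] and [b], and [sg * Rabs (z 1)] is the height over the edge. *)
  set (E := fun (z : nat -> R) i =>
    (1 - sg * Rabs (z 1%nat) + sg * z 0%nat) / 2 * delta a i +
    (1 - sg * Rabs (z 1%nat) - sg * z 0%nat) / 2 * delta b i +
    sg * Rmax 0 (z 1%nat) * delta c i + sg * Rmax 0 (- z 1%nat) * delta d i).
  assert (Hw : forall z, square z ->
    0 <= (1 - sg * Rabs (z 1%nat) + sg * z 0%nat) / 2 /\
    0 <= (1 - sg * Rabs (z 1%nat) - sg * z 0%nat) / 2 /\ 0 <= sg * Rabs (z 1%nat)).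
  { intros z (_ & H0 & H1). apply Rabs_le_between in H0. assert (HP := Rabs_pos (z 1%nat)).
    split; [|split]; nra. }
  assert (HEA : forall z, square z -> A (E z)).
  { intros z Hz; destruct (Hw z Hz) as (W1 & W2 & W3).
    destruct (Rle_dec 0 (z 1%nat)) as [Hs|Hs].
    - rewrite Rabs_pos_eq in W1, W2, W3 by exact Hs.
      replace (E z) with (bary a b c ((1 - sg * z 1%nat + sg * z 0%nat) / 2)
        ((1 - sg * z 1%nat - sg * z 0%nat) / 2) (sg * z 1%nat)).
      + apply Hfc, bary_supported; auto; lra.
      + apply functional_extensionality; intros i; unfold E, bary.
        rewrite (Rmax_right 0), (Rmax_left 0), Rabs_pos_eq by lra; ring.
    - rewrite Rabs_left in W1, W2, W3 by lra.
      replace (E z) with (bary a b d ((1 - sg * - z 1%nat + sg * z 0%nat) / 2)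
        ((1 - sg * - z 1%nat - sg * z 0%nat) / 2) (sg * - z 1%nat)).
      + apply Hfd, bary_supported; auto; lra.
      + apply functional_extensionality; intros i; unfold E, bary.
        rewrite (Rmax_left 0), (Rmax_right 0), Rabs_left by lra; ring. }
  assert (HEa : forall z, E z a = (1 - sg * Rabs (z 1%nat) + sg * z 0%nat) / 2).
  { intros z; unfold E; rewrite delta_same, !delta_diff by auto; ring. }
  assert (HEb : forall z, E z b = (1 - sg * Rabs (z 1%nat) - sg * z 0%nat) / 2).
  { intros z; unfold E; rewrite delta_same, !delta_diff by auto; ring. }
  assert (HEc : forall z, E z c = sg * Rmax 0 (z 1%nat)).
  { intros z; unfold E; rewrite delta_same, !delta_diff by auto; ring. }
  assert (HEd : forall z, E z d = sg * Rmax 0 (- z 1%nat)).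
  { intros z; unfold E; rewrite delta_same, !delta_diff by auto; ring. }
  assert (HEe : forall z, E z e = 0).
  { intros z; unfold E; rewrite !delta_diff by auto; ring. }
  assert (HEp : forall z, square z -> forall i, Rabs (E z i - p i) <= sg).
  { intros z (_ & H0 & H1) i. rewrite (Ep c); unfold E, bary.
    apply Rabs_le_between in H0. assert (HP := Rabs_pos (z 1%nat)).
    assert (HM1 : 0 <= Rmax 0 (z 1%nat) <= 1).
    { apply Rabs_le_between in H1; split; [apply Rmax_l|apply Rmax_lub; lra]. }
    assert (HM2 : 0 <= Rmax 0 (- z 1%nat) <= 1).
    { apply Rabs_le_between in H1; split; [apply Rmax_l|apply Rmax_lub; lra]. }
    assert (M : forall t, -1 <= t <= 1 -> - sg <= sg * t <= sg) by (intros; split; nra).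
    assert (M0 : forall t, 0 <= t -> 0 <= sg * t) by (intros; nra).
    assert (N1 := M _ H0). assert (N2 := M (Rabs (z 1%nat)) ltac:(lra)).
    assert (N3 := M (Rmax 0 (z 1%nat)) ltac:(lra)).
    assert (N4 := M (Rmax 0 (- z 1%nat)) ltac:(lra)).
    assert (N5 := M0 _ HP). assert (N6 := M0 _ (proj1 HM1)). assert (N7 := M0 _ (proj1 HM2)).
    apply Rabs_le_between; unfold delta.
    destruct (Nat.eqb_spec i a), (Nat.eqb_spec i b), (Nat.eqb_spec i c), (Nat.eqb_spec i d);
      try congruence; split; lra. }
  assert (HEU : forall z, square z -> U (E z)) by (intros z Hz; apply Hsgf; auto).
  assert (HEq : forall z, square z -> forall i, (i < 2)%nat -> Rabs (f (E z) i - q i) < R1 / 2)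
    by (intros z Hz; apply Hsgf; auto).
  (* The translation is complete on the inner half of the square and vanishes on the boundary. *)
  set (lam := fun z => Rmin 1 (2 * (1 - zmax z))).
  assert (Hlam : forall z, square z -> 0 <= lam z <= 1).
  { intros z Hz; destruct (zmax_le z Hz); split; [apply Rmin_glb; lra|apply Rmin_l]. }
  set (phi := fun z i => f (E z) i + lam z * (q i - q' i)).
  assert (Hphi_in : forall z, square z -> in_Rd 2 (phi z)).
  { intros z Hz i Hi; unfold phi. rewrite (HVin _ (HfV _ (HEU z Hz)) i Hi).
    rewrite (HVin _ HVq i Hi), (HVin _ (HfV _ HUp') i Hi : q' i = 0); ring. }
  assert (Hphi_q : forall z, square z -> V (phi z) /\ dist n p (g (phi z)) < 1 / 2).
  { intros z Hz; apply HR1V; [apply Hphi_in, Hz|]; intros i Hi.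
    assert (D1 := HEq z Hz i Hi). assert (D2 := Hq' i Hi). destruct (Hlam z Hz).
    apply Rabs_lt_between in D1. apply Rabs_lt_between in D2.
    apply Rabs_lt_between; unfold phi; split; nra. }
  assert (HphiV : forall z, square z -> V (phi z)) by (intros z Hz; apply Hphi_q, Hz).
  (* On page [d] the second coordinate is minus the height over the edge, on every other page it is
     the height. So [kap] undoes [E] up to the factor [sg], and on the pages it vanishes only at
     [p]. *)
  set (kap := fun (x : nat -> R) (i : nat) =>
    match i with O => x a - x b | _ => 1 - x a - x b - 2 * x d end).
  assert (Hkc : forall (B : space) i, rcont n B (fun x => kap x i)).
  { intros B [|i]; unfold kap; rcont_tac. }
  assert (HEcont : continuous_on 2 n square E).
  { apply continuous_on_coords; intros i Hi; unfold E; rcont_tac. }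
  assert (Hphic : continuous_on 2 2 square phi).
  { apply continuous_on_coords; intros i Hi; unfold phi. apply rcont_plus.
    - apply (rcont_comp_map 2 n square U E (fun y => f y i)); auto.
      apply (rcont_of_continuous_on n 2); auto.
    - apply rcont_mult; [|apply rcont_const]. unfold lam.
      apply rcont_min; [apply rcont_const|]. apply rcont_mult; [apply rcont_const|].
      apply rcont_minus; [apply rcont_const|apply rcont_zmax]. }
  destruct (no_retraction (fun z => kap (g (phi z))) (fun _ => 0) sg Hsg) as (z & Hz & Ez).
  - intros i Hi. apply (rcont_comp_map 2 2 square V phi (fun y => kap (g y) i)); auto.
    apply (rcont_comp_map 2 n V U g (fun y => kap y i)); auto.
  - intros z Hz E1 i Hi.
    assert (Ephi : phi z = f (E z)).
    { apply functional_extensionality; intros k; unfold phi, lam; rewrite E1.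
      rewrite Rmin_right by lra; ring. }
    rewrite Ephi, Hgf by (apply HEU, Hz).
    unfold kap; rewrite HEa, HEb, HEd.
    destruct i as [|[|i]]; [lra| |lia].
    unfold Rmax, Rabs; destruct (Rcase_abs _), (Rle_dec _ _); try lra.
    assert (Hz1 : z 1%nat = 0) by lra; rewrite Hz1; lra.
  - assert (HVz := HphiV z Hz).
    assert (Egp : g (phi z) = p).
    { assert (Hdp := proj2 (Hphi_q z Hz)).
      assert (HAg : A (g (phi z))) by (apply HUA, HgU, HVz).
      destruct (Hstar (g (phi z)) HAg) as (w & Hw0 & Hwa & Hwb & Hsup).
      - assert (D := coord_le_dist n p (g (phi z)) a Ha).
        apply Rabs_le_between in D; lra.
      - assert (D := coord_le_dist n p (g (phi z)) b Hb).
        apply Rabs_le_between in D; lra.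
      - assert (S1 := supported_sum n a b w _ Ha Hb Hw0 Hab ltac:(auto) ltac:(auto) Hsup).
        assert (K0 := Ez 0%nat ltac:(lia)). assert (K1 := Ez 1%nat ltac:(lia)).
        unfold kap in K0, K1.
        assert (W0 : g (phi z) w = 0).
        { destruct (Nat.eq_dec w d) as [->|Hwd]; [lra|].
          assert (Xd : g (phi z) d = 0).
          { apply NNPP; intros Hx; destruct Hsup as (_ & _ & _ & Hs).
            destruct (Hs d Hx) as [|[|]]; congruence. }
          lra. }
        rewrite (supported_bary n a b w _ Hab ltac:(auto) ltac:(auto) Hsup), W0, (Ep w).
        f_equal; lra. }
    assert (Ephi : phi z = q) by (rewrite <- (Hfg (phi z) HVz), Egp; reflexivity).
    (* On the inner half the full translation gives [f (E z) = q'], so [E z] would be [p'], which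
       has weight [tau] at [e]. On the rest [f (E z)] is within [m] of [q], and the choice of [m]
       puts [z] back in the inner half. *)
    destruct (Rle_dec (zmax z) (1 / 2)) as [Hin|Hout].
    + assert (Ef : f (E z) = q').
      { apply functional_extensionality; intros i.
        assert (X := f_equal (fun x => x i) Ephi); unfold phi, lam in X; simpl in X.
        rewrite Rmin_left in X by lra; lra. }
      assert (EE : E z = p').
      { rewrite <- (Hgf (E z)), Ef by (apply HEU, Hz); apply Hgf, HUp'. }
      assert (X := HEe z). rewrite EE, Hp'e in X; lra.
    + destruct (HmV (f (E z))) as [_ Hdist].
      * apply HVin, HfV, HEU, Hz.
      * intros i Hi.
        assert (X := f_equal (fun x => x i) Ephi); unfold phi in X; simpl in X.
        assert (D := Hq' i Hi). destruct (Hlam z Hz).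
        apply Rabs_lt_between in D. apply Rabs_lt_between; split; nra.
      * rewrite Hgf in Hdist by (apply HEU, Hz).
        apply Hout; unfold zmax; apply Rmax_lub.
        -- assert (Da := coord_le_dist n p (E z) a Ha).
           assert (Db := coord_le_dist n p (E z) b Hb).
           rewrite HEa, Hpa in Da. rewrite HEb, Hpb in Db.
           apply Rabs_le_between in Da. apply Rabs_le_between in Db.
           apply Rabs_le_between; split; apply (Rmult_le_reg_l sg); lra.
        -- assert (Dc := coord_le_dist n p (E z) c Hc).
           assert (Dd := coord_le_dist n p (E z) d Hd).
           rewrite HEc, Hpc in Dc.
           rewrite HEd, Hpd in Dd.
           apply Rabs_le_between in Dc. apply Rabs_le_between in Dd.
           assert (M1 := Rmax_r 0 (z 1%nat)). assert (M2 := Rmax_r 0 (- z 1%nat)).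
           apply (Rmult_le_compat_l sg) in M1; [|lra]. apply (Rmult_le_compat_l sg) in M2; [|lra].
           apply Rabs_le_between; split; apply (Rmult_le_reg_l sg); lra.
Qed.

(** * The degenerate complexes *)

(** The vertices of a simplex are residues of sums of at most three terms, each at most [N]; naming
    the three possible quotients reduces incidence questions to linear arithmetic. *)
Lemma mod_cases k N :
  (0 < N)%nat -> (k < 3 * N)%nat ->
  (k < N /\ k mod N = k)%nat \/ (N <= k < 2 * N /\ k mod N = k - N)%nat \/
  (2 * N <= k /\ k mod N = k - 2 * N)%nat.
Proof.
  intros HN Hk.
  destruct (Nat.lt_ge_cases k N) as [H1|H1]; [left; split; [lia|apply Nat.mod_small, H1]|].
  destruct (Nat.lt_ge_cases k (2 * N)) as [H2|H2]; right; [left|right]; split; try lia; symmetry.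
  - apply (Nat.mod_unique k N 1); lia.
  - apply (Nat.mod_unique k N 2); lia.
Qed.

Ltac case_mod k N :=
  let m := fresh "m" in
  let E := fresh "E" in
  destruct (mod_cases k N ltac:(lia) ltac:(lia)) as [[? E]|[[? E]|[? E]]];
  try (exfalso; lia); set (m := Nat.modulo k N) in *; clearbody m.

Ltac case_mods N :=
  repeat match goal with
  | |- context [Nat.modulo ?k N] => case_mod k N
  | _ : context [Nat.modulo ?k N] |- _ => case_mod k N
  end.

Lemma face_in_realization N n1 n2 n3 a b c x s :
  simplex_C N n1 n2 n3 s -> In a s -> In b s -> In c s ->
  supported N a b c x -> realization N n1 n2 n3 x.
Proof.
  intros Hs Ha Hb Hc (Hin & Hpos & Hsum & Hsup); split; [exact Hin|].
  split; [exact Hpos|]; split; [exact Hsum|]; exists s; split; [exact Hs|].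
  intros i _ Hi; destruct (Hsup i Hi) as [-> | [-> | ->]]; assumption.
Qed.

Lemma star_supported N n1 n2 n3 a b c x :
  (a < N)%nat -> (b < N)%nat ->
  (forall s, simplex_C N n1 n2 n3 s -> In a s -> In b s ->
     forall i, In i s -> i = a \/ i = b \/ i = c) ->
  realization N n1 n2 n3 x -> 0 < x a -> 0 < x b -> supported N a b c x.
Proof.
  intros Ha Hb H (Hin & Hpos & Hsum & s & Hs & Hsup) Hxa Hxb.
  split; [exact Hin|]; split; [exact Hpos|]; split; [exact Hsum|]; intros i Hi.
  destruct (Nat.lt_ge_cases i N) as [HiN|HiN]; [|elim Hi; apply Hin, HiN].
  apply (H s Hs); [apply Hsup| apply Hsup| apply Hsup]; auto; lra.
Qed.

Lemma simplex_C_size N n1 n2 n3 s : simplex_C N n1 n2 n3 s -> (length s <= 3)%nat.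
Proof.
  intros [(k & _ & ->)|[(k & j & _ & _ & ->)|(k & _ & [-> | ->])]]; simpl; lia.
Qed.

(** The carrier contains [a], [b] and at most one further vertex. The vertex [c] is only a default
    page, for points on the edge itself. *)
Lemma star_pages N n1 n2 n3 a b c x :
  (a < N)%nat -> (b < N)%nat -> (c < N)%nat -> a <> b -> c <> a -> c <> b ->
  realization N n1 n2 n3 x -> 0 < x a -> 0 < x b ->
  exists w, (w < N)%nat /\ w <> a /\ w <> b /\ supported N a b w x.
Proof.
  intros Ha Hb Hc Hab Hca Hcb (Hin & Hpos & Hsum & s & Hs & Hsup) Hxa Hxb.
  assert (Hsa : In a s) by (apply Hsup; [exact Ha|lra]).
  assert (Hsb : In b s) by (apply Hsup; [exact Hb|lra]).
  assert (Hw : exists w, forall i, In i s -> i = a \/ i = b \/ i = w).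
  { assert (Hlen := simplex_C_size _ _ _ _ _ Hs).
    destruct s as [|s1 [|s2 [|s3 [|s4 s]]]]; simpl in *; try lia.
    - exists c; intros i Hi; lia.
    - assert (E : (s1 <> a /\ s1 <> b) \/ (s2 <> a /\ s2 <> b) \/ (s1 = a \/ s1 = b) /\ (s2 = a \/ s2 = b))
        by lia.
      destruct E as [E|[E|E]]; [exists s1|exists s2|exists s3]; intros i Hi; lia. }
  destruct Hw as [w Hw].
  assert (Hsp : forall i, x i <> 0 -> (i < N)%nat /\ (i = a \/ i = b \/ i = w)).
  { intros i Hi. destruct (Nat.lt_ge_cases i N) as [HiN|HiN]; [|elim Hi; apply Hin, HiN].
    split; [exact HiN|]; apply Hw, Hsup; assumption. }
  destruct (classic ((w < N)%nat /\ w <> a /\ w <> b)) as [(W1 & W2 & W3)|Hno].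
  - exists w; repeat split; auto; intros i Hi; apply Hsp, Hi.
  - exists c; repeat split; auto; intros i Hi; destruct (Hsp i Hi); lia.
Qed.

(** On the edge {0, 2n}, the triangle {0, n, 2n} equals its own inversion {2n, n, 0}. A second
    triangle {2n, 3n, 4n} would need 4n = N, that is n3 = 2n. *)
Lemma not_surface_equal_small N n n3 :
  (1 <= n)%nat -> (n <= n3)%nat -> (n + n + n3)%nat = N -> n3 <> (2 * n)%nat ->
  ~ is_surface N (realization N n n n3).
Proof.
  intros Hn Hn3 HN Hne.
  apply (free_edge_not_surface N _ 0 (2 * n) n); try lia.
  - intros x Hx.
    apply (face_in_realization N n n n3 0 (2 * n) n x [0; n; 2 * n]%nat); simpl; auto.
    right; right; exists 0%nat; split; [lia|left].
    rewrite !Nat.mod_small by lia. repeat (apply f_equal2; [lia|]); reflexivity.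
  - intros x Hx; apply (star_supported N n n n3); auto; try lia.
    intros s Hs; destruct Hs as [(k & Hk & ->)|[(k & j & Hk & Hj & ->)|(k & Hk & [-> | ->])]];
      case_mods N; simpl; intros; lia.
Qed.

(** The edge {0, n1} has the apices n1 + n2 and -n2 = n1 + n3, which coincide when n2 = n3. *)
Lemma not_surface_equal_large N n1 n :
  (1 <= n1)%nat -> (n1 < n)%nat -> (n1 + n + n)%nat = N ->
  ~ is_surface N (realization N n1 n n).
Proof.
  intros Hn Hn3 HN.
  apply (free_edge_not_surface N _ 0 n1 (n1 + n)); try lia.
  - intros x Hx.
    apply (face_in_realization N n1 n n 0 n1 (n1 + n) x [0; n1; n1 + n]%nat); simpl; auto.
    right; right; exists 0%nat; split; [lia|left].
    rewrite !Nat.mod_small by lia. reflexivity.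
  - intros x Hx; apply (star_supported N n1 n n); auto; try lia.
    intros s Hs; destruct Hs as [(k & Hk & ->)|[(k & j & Hk & Hj & ->)|(k & Hk & [-> | ->])]];
      case_mods N; simpl; intros; lia.
Qed.

(** Since 2 n3 = N, the edge {0, n3} lies in the triangles with apices n1, n2, n3 + n1 and n3 + n2;
    three of them suffice for the obstruction. *)
Lemma not_surface_half N n1 n2 :
  (1 <= n1)%nat -> (n1 < n2)%nat -> (n1 + n2 + (n1 + n2))%nat = N ->
  ~ is_surface N (realization N n1 n2 (n1 + n2)).
Proof.
  intros Hn Hn3 HN. set (n3 := (n1 + n2)%nat).
  assert (Hn3e : n3 = (n1 + n2)%nat) by reflexivity. clearbody n3.
  apply (three_pages_not_surface N _ 0 n3 n1 n2 (n3 + n1)); try lia.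
  - repeat constructor; simpl; lia.
  - intros x; apply (face_in_realization N n1 n2 n3 _ _ _ x [0; n1; n3]%nat); simpl; auto.
    right; right; exists 0%nat; split; [lia|left].
    rewrite !Nat.mod_small by lia. subst n3; reflexivity.
  - intros x; apply (face_in_realization N n1 n2 n3 _ _ _ x [n3; n2; 0]%nat); simpl; auto.
    right; right; exists n3; split; [lia|right]. case_mods N.
    repeat (apply f_equal2; [lia|]); reflexivity.
  - intros x; apply (face_in_realization N n1 n2 n3 _ _ _ x [n3; n3 + n1; 0]%nat); simpl; auto.
    right; right; exists n3; split; [lia|left]. case_mods N.
    repeat (apply f_equal2; [lia|]); reflexivity.
  - intros x; apply (star_pages N n1 n2 n3 0 n3 n1); lia.
Qed.

(** * The tetrahedral complexes *)

(* Inner products with the vertices of a regular tetrahedron centred at the origin. *)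
Definition tdot (m : nat) (z : nat -> R) : R :=
  match m with
  | 0%nat => z 0%nat + z 1%nat + z 2%nat
  | 1%nat => z 0%nat - z 1%nat - z 2%nat
  | 2%nat => - z 0%nat + z 1%nat - z 2%nat
  | _ => - z 0%nat - z 1%nat + z 2%nat
  end.

(** The gauge of the solid tetrahedron where every [tdot m z] is at least -1; dividing by it
    projects radially to the boundary. *)
Definition tgauge (z : nat -> R) : R :=
  Rmax (Rmax (- tdot 0 z) (- tdot 1 z)) (Rmax (- tdot 2 z) (- tdot 3 z)).

(* Barycentric coordinates of the radial projection of [z] to the tetrahedron. *)
Definition tweight (z : nat -> R) (m : nat) : R := / 4 + tdot m z / (4 * tgauge z).

(** A continuous substitute for [delta]: it selects the level [j] among integer heights and keeps
    [tmap] a single continuous formula. *)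
Definition bump (t : R) : R := Rmax 0 (1 - Rabs t).

(** The vertices of the [j]-th tetrahedron are j, j + n, j + 2n and j + 3n. *)
Definition tmap (n : nat) (z : nat -> R) (i : nat) : R :=
  rsum 4 (fun m => tweight z m *
    rsum n (fun j => bump (z 3%nat - INR j) * delta (j + m * n) i)).

Lemma bump_INR j l : bump (INR j - INR l) = delta j l.
Proof.
  unfold bump, delta; destruct (Nat.eqb_spec l j) as [->|Hne].
  - rewrite Rminus_diag, Rabs_R0, Rmax_right; lra.
  - apply Rmax_left. assert (1 <= Rabs (INR j - INR l)); [|lra].
    rewrite !INR_IZR_INZ, <- minus_IZR, <- abs_IZR; apply IZR_le; lia.
Qed.

Lemma tmap_level n z j i :
  (j < n)%nat -> z 3%nat = INR j ->
  tmap n z i = rsum 4 (fun m => tweight z m * delta (j + m * n) i).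
Proof.
  intros Hj E; unfold tmap; apply rsum_ext; intros m _; f_equal.
  rewrite <- (rsum_delta_mul n j (fun l => delta (l + m * n) i) Hj).
  apply rsum_ext; intros l _; rewrite E, bump_INR; reflexivity.
Qed.

Lemma tgauge_ge z m : (m < 4)%nat -> - tdot m z <= tgauge z.
Proof.
  intros Hm; unfold tgauge.
  destruct m as [|[|[|[|m]]]]; [| | | |lia]; eapply Rle_trans.
  - apply Rmax_l.
  - apply Rmax_l.
  - apply Rmax_r.
  - apply Rmax_l.
  - apply Rmax_l.
  - apply Rmax_r.
  - apply Rmax_r.
  - apply Rmax_r.
Qed.

Lemma tgauge_attained z : exists m, (m < 4)%nat /\ tgauge z = - tdot m z.
Proof.
  unfold tgauge, Rmax; repeat destruct (Rle_dec _ _);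
    first [exists 0%nat; split; [lia|reflexivity] | exists 1%nat; split; [lia|reflexivity]
          | exists 2%nat; split; [lia|reflexivity] | exists 3%nat; split; [lia|reflexivity]].
Qed.

(** The four values [tdot m z] add up to 0, so if none is negative they all vanish, and so does the
    vector. *)
Lemma tgauge_pos z : z 0%nat ^ 2 + z 1%nat ^ 2 + z 2%nat ^ 2 = 1 -> 0 < tgauge z.
Proof.
  intros H; apply Rnot_le_lt; intros Hle.
  assert (H0 := tgauge_ge z 0 ltac:(lia)). assert (H1 := tgauge_ge z 1 ltac:(lia)).
  assert (H2 := tgauge_ge z 2 ltac:(lia)). assert (H3 := tgauge_ge z 3 ltac:(lia)).
  simpl in H0, H1, H2, H3.
  assert (z 0%nat = 0) by lra. assert (z 1%nat = 0) by lra. assert (z 2%nat = 0) by lra.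
  rewrite H4, H5, H6 in H; lra.
Qed.

Lemma tweight_nonneg z m : 0 < tgauge z -> (m < 4)%nat -> 0 <= tweight z m.
Proof.
  intros Hp Hm; assert (H := tgauge_ge z m Hm); unfold tweight.
  replace (/ 4 + tdot m z / (4 * tgauge z)) with ((tgauge z + tdot m z) / (4 * tgauge z))
    by (field; lra).
  apply Rdiv_le_0_compat; lra.
Qed.

Lemma tweight_sum z : rsum 4 (tweight z) = 1.
Proof. simpl; unfold tweight, tdot, Rdiv; ring_simplify; lra. Qed.

Lemma tweight_zero z : 0 < tgauge z -> exists m, (m < 4)%nat /\ tweight z m = 0.
Proof.
  intros Hp; destruct (tgauge_attained z) as (m & Hm & E); exists m; split; [exact Hm|].
  unfold tweight; replace (tdot m z) with (- tgauge z) by lra; field; lra.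
Qed.

Lemma spheres_compact n : seq_compact 4 (spheres n).
Proof.
  apply (closed_bounded_compact 4 (spheres n) (1 + INR n)).
  - intros x Hx; apply Hx.
  - intros x i (Hin & (j & Hj & Ej) & E). assert (H0 := pos_INR n).
    destruct i as [|[|[|[|i]]]].
    + apply Rabs_le_between; split; nra.
    + apply Rabs_le_between; split; nra.
    + apply Rabs_le_between; split; nra.
    + rewrite Ej, Rabs_pos_eq by apply pos_INR. apply lt_INR in Hj; lra.
    + rewrite Hin, Rabs_R0 by lia; lra.
  - intros l Hin Hl; split; [exact Hin|]; split.
    + apply (closed_level 4 (spheres n)); auto. intros x Hx; apply Hx.
    + apply (closed_eq 4 (spheres n) (fun x => x 0%nat ^ 2 + x 1%nat ^ 2 + x 2%nat ^ 2)); auto.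
      * rcont_tac.
      * intros x Hx; apply Hx.
Qed.

Lemma tmap_continuous n : continuous_on 4 (n + n + 2 * n) (spheres n) (tmap n).
Proof.
  apply continuous_on_coords; intros i Hi; unfold tmap.
  apply (rcont_rsum 4 (spheres n) 4 (fun m z => tweight z m *
    rsum n (fun j => bump (z 3%nat - INR j) * delta (j + m * n) i))); intros m Hm.
  assert (Hdot : forall k, rcont 4 (spheres n) (tdot k)).
  { intros [|[|[|k]]]; unfold tdot; rcont_tac. }
  apply rcont_mult.
  - unfold tweight. apply rcont_plus; [apply rcont_const|].
    apply rcont_mult; [apply Hdot|]. apply (rcont_inv _ _ (fun x => 4 * tgauge x)).
    + apply rcont_mult; [apply rcont_const|]. unfold tgauge.
      repeat apply rcont_max; apply rcont_opp, Hdot.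
    + intros z (_ & _ & Hz). assert (H := tgauge_pos z Hz); lra.
  - apply (rcont_rsum 4 (spheres n) n
      (fun j z => bump (z 3%nat - INR j) * delta (j + m * n) i)); intros j Hj.
    unfold bump; rcont_tac.
Qed.

Lemma tmap_in n z :
  (1 <= n)%nat -> spheres n z -> realization (n + n + 2 * n) n n (2 * n) (tmap n z).
Proof.
  intros Hn (Hin & (j & Hj & Ej) & Hz).
  assert (Hp := tgauge_pos z Hz).
  assert (E := fun i => tmap_level n z j i Hj Ej).
  split; [|split; [|split]].
  - intros i Hi; rewrite E; apply rsum_0; intros m Hm. rewrite delta_diff; [lra|nia].
  - intros i; rewrite E; apply rsum_nonneg; intros m Hm.
    assert (H := tweight_nonneg z m Hp Hm).
    unfold delta; destruct (Nat.eqb _ _); lra.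
  - rewrite (rsum_ext _ _ _ (fun i _ => E i)), rsum_swap, <- (tweight_sum z).
    apply rsum_ext; intros m Hm. rewrite rsum_scal, rsum_delta; [lra|nia].
  - assert (Hsup : forall i, tmap n z i <> 0 ->
      exists m, (m < 4)%nat /\ i = (j + m * n)%nat /\ tweight z m <> 0).
    { intros i Hi; apply NNPP; intros Hno; apply Hi; rewrite E; apply rsum_0; intros m Hm.
      destruct (Nat.eq_dec i (j + m * n)) as [Ei|Hne]; [|rewrite delta_diff; [lra|exact Hne]].
      destruct (Req_dec (tweight z m) 0) as [->|Hw]; [lra|].
      elim Hno; exists m; auto. }
    destruct (tweight_zero z Hp) as (m0 & Hm0 & Ez).
    (* The face opposite the vertex of weight 0 starts at the next vertex in cyclic order; after m0
       = 3 this is the vertex 0. *)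
    set (k := (j + (if Nat.eqb m0 3 then 0 else S m0) * n)%nat).
    assert (Hk : (k < 4 * n)%nat).
    { unfold k; destruct (Nat.eqb_spec m0 3); nia. }
    exists [k; ((k + n) mod (n + n + 2 * n))%nat; ((k + n + n) mod (n + n + 2 * n))%nat].
    split; [right; right; exists k; split; [lia|left; reflexivity]|].
    intros i Hi Hx. destruct (Hsup i Hx) as (m & Hm & -> & Hw).
    assert (Hmm : m <> m0) by congruence. clear E Hsup Hw Hx Ez.
    subst k; set (N := (n + n + 2 * n)%nat) in *.
    assert (HN : N = (4 * n)%nat) by (unfold N; lia). clearbody N.
    assert (C0 : (m0 = 0 \/ m0 = 1 \/ m0 = 2 \/ m0 = 3)%nat) by lia.
    assert (C1 : (m = 0 \/ m = 1 \/ m = 2 \/ m = 3)%nat) by lia.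
    destruct C0 as [-> | [-> | [-> | ->]]], C1 as [-> | [-> | [-> | ->]]]; try lia;
      cbn [Nat.eqb] in *; case_mods N; simpl; lia.
Qed.

Lemma tmap_injective n z z' :
  (1 <= n)%nat -> spheres n z -> spheres n z' -> tmap n z = tmap n z' -> z = z'.
Proof.
  intros Hn (Hin & (j & Hj & Ej) & Hz) (Hin' & (j' & Hj' & Ej') & Hz') E.
  assert (Hp := tgauge_pos z Hz). assert (Hp' := tgauge_pos z' Hz').
  assert (Hval : forall (l m : nat) y, (l < n)%nat -> (m < 4)%nat -> y 3%nat = INR l ->
    tmap n y (l + m * n)%nat = tweight y m).
  { intros l m y Hl Hm Ey. rewrite (tmap_level n y l _ Hl Ey).
    rewrite <- (rsum_delta_mul 4 m (tweight y) Hm). apply rsum_ext; intros k Hk.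
    destruct (Nat.eq_dec k m) as [->|Hne]; [rewrite !delta_same; ring|].
    rewrite !delta_diff; [ring|exact Hne|nia]. }
  (* Different levels use disjoint sets of vertices, while the weights of [z] sum to 1 and cannot
     all vanish. *)
  assert (Ejj : j = j').
  { apply NNPP; intros Hne.
    assert (Hall : forall m, (m < 4)%nat -> tweight z m = 0).
    { intros m Hm; rewrite <- (Hval j m z Hj Hm Ej), E, (tmap_level n z' j' _ Hj' Ej').
      apply rsum_0; intros k Hk; rewrite delta_diff; [ring|].
      intros Eq. apply Hne.
      assert (X : (m = k)%nat); [|subst; lia].
      destruct (Nat.lt_trichotomy m k) as [|[|]]; [|assumption|]; exfalso; nia. }
    assert (S := tweight_sum z). rewrite rsum_0 in S; [lra|exact Hall]. }
  subst j'.
  assert (Hw : forall m, (m < 4)%nat -> tdot m z / tgauge z = tdot m z' / tgauge z').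
  { intros m Hm. assert (X := Hval j m z Hj Hm Ej). rewrite E, (Hval j m z' Hj Hm Ej') in X.
    unfold tweight in X.
    replace (tdot m z / (4 * tgauge z)) with (tdot m z / tgauge z / 4) in X by (field; lra).
    replace (tdot m z' / (4 * tgauge z')) with (tdot m z' / tgauge z' / 4) in X by (field; lra).
    lra. }
  (* Equal weights make the spatial parts of [z] and [z'] positive multiples of each other; both
     have norm 1. *)
  set (c := tgauge z / tgauge z').
  assert (Hc : 0 < c) by (apply Rdiv_lt_0_compat; assumption).
  assert (Hd : forall m, (m < 4)%nat -> tdot m z = c * tdot m z').
  { intros m Hm; unfold c.
    replace (tdot m z) with (tdot m z / tgauge z * tgauge z) by (field; lra).
    rewrite (Hw m Hm); field; lra. }
  assert (D0 := Hd 0%nat ltac:(lia)). assert (D1 := Hd 1%nat ltac:(lia)).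
  assert (D2 := Hd 2%nat ltac:(lia)). assert (D3 := Hd 3%nat ltac:(lia)).
  simpl in D0, D1, D2, D3.
  assert (Z0 : z 0%nat = c * z' 0%nat) by lra.
  assert (Z1 : z 1%nat = c * z' 1%nat) by lra.
  assert (Z2 : z 2%nat = c * z' 2%nat) by lra.
  assert (Hc1 : c = 1).
  { rewrite Z0, Z1, Z2 in Hz.
    assert (Hcc : c ^ 2 = 1) by (rewrite <- Hz, <- (Rmult_1_r (c ^ 2)), <- Hz' at 1; ring). nra. }
  rewrite Hc1 in Z0, Z1, Z2.
  apply (in_Rd_ext 4); auto. intros [|[|[|[|i]]]] Hi; try lia; lra.
Qed.

(** All differences are multiples of [n], so the vertices share their residue modulo [n]; at most
    three of the four vertices with that residue are used. *)
Lemma tetrahedral_simplex n s :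
  (1 <= n)%nat -> simplex_C (n + n + 2 * n) n n (2 * n) s ->
  exists j m0, (j < n)%nat /\ (m0 < 4)%nat /\
    forall i, In i s -> exists m, (m < 4)%nat /\ m <> m0 /\ i = (j + m * n)%nat.
Proof.
  intros Hn Hs. set (N := (n + n + 2 * n)%nat) in *.
  assert (HN : N = (4 * n)%nat) by (unfold N; lia). clearbody N.
  assert (Hk : forall k, (k < N)%nat -> exists j m, (j < n)%nat /\
    (m = 0 \/ m = 1 \/ m = 2 \/ m = 3)%nat /\ k = (j + m * n)%nat).
  { intros k Hk; exists (k mod n)%nat, (k / n)%nat.
    assert (A1 := Nat.mod_upper_bound k n ltac:(lia)). assert (A2 := Nat.div_mod_eq k n).
    split; [exact A1|]; split; [|lia].
    assert (k / n < 4)%nat by (apply Nat.Div0.div_lt_upper_bound; lia). lia. }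
  assert (Hfin : forall (j m0 : nat) (l : list nat), (j < n)%nat -> (m0 < 4)%nat ->
    List.Forall (fun i => exists m, (m < 4)%nat /\ m <> m0 /\ i = (j + m * n)%nat) l ->
    exists j m0, (j < n)%nat /\ (m0 < 4)%nat /\
      forall i, In i l -> exists m, (m < 4)%nat /\ m <> m0 /\ i = (j + m * n)%nat).
  { intros j m0 l Hj Hm0 Hl; exists j, m0; split; [exact Hj|]; split; [exact Hm0|].
    apply List.Forall_forall, Hl. }
  destruct Hs as [(k & Hk' & ->)|[(k & l & Hk' & Hl & ->)|(k & Hk' & [-> | ->])]];
    destruct (Hk k Hk') as (j & m & Hj & Hm & E); clear Hk;
    destruct Hm as [-> | [-> | [-> | ->]]];
    try (assert (Hl' : (l = n \/ l = 2 * n)%nat) by lia; clear Hl; destruct Hl' as [-> | ->]);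
    case_mods N;
    first [ apply (Hfin j 0%nat); [exact Hj|lia|]; repeat constructor;
            first [exists 1%nat; lia | exists 2%nat; lia | exists 3%nat; lia]
          | apply (Hfin j 1%nat); [exact Hj|lia|]; repeat constructor;
            first [exists 0%nat; lia | exists 2%nat; lia | exists 3%nat; lia]
          | apply (Hfin j 2%nat); [exact Hj|lia|]; repeat constructor;
            first [exists 0%nat; lia | exists 1%nat; lia | exists 3%nat; lia]
          | apply (Hfin j 3%nat); [exact Hj|lia|]; repeat constructor;
            first [exists 0%nat; lia | exists 1%nat; lia | exists 2%nat; lia] ].
Qed.

Lemma tmap_surjective n x :
  (1 <= n)%nat -> realization (n + n + 2 * n) n n (2 * n) x ->
  exists z, spheres n z /\ tmap n z = x.
Proof.
  intros Hn (Hin & Hpos & Hsum & s & Hs & Hsup).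
  destruct (tetrahedral_simplex n s Hn Hs) as (j & m0 & Hj & Hm0 & Hsj).
  set (y := fun m => x (j + m * n)%nat).
  assert (Hy0 : y m0 = 0).
  { apply NNPP; intros H; destruct (Hsj (j + m0 * n)%nat) as (m & Hm & Hne & E).
    - apply Hsup; [nia|exact H].
    - apply Hne. destruct (Nat.lt_trichotomy m m0) as [|[|]]; [|assumption|]; exfalso; nia. }
  assert (Ex : forall i, x i = rsum 4 (fun m => y m * delta (j + m * n) i)).
  { intros i. destruct (classic (exists m, (m < 4)%nat /\ i = (j + m * n)%nat)) as [(m & Hm & ->)|Hno].
    - change (x (j + m * n)%nat) with (y m). rewrite <- (rsum_delta_mul 4 m y Hm).
      apply rsum_ext; intros k Hk.
      destruct (Nat.eq_dec k m) as [->|Hne]; [rewrite !delta_same; ring|].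
      rewrite !delta_diff; [ring|nia|exact Hne].
    - rewrite rsum_0.
      + apply NNPP; intros H. destruct (Nat.lt_ge_cases i (n + n + 2 * n)) as [Hi|Hi].
        * destruct (Hsj i (Hsup i Hi H)) as (m & Hm & _ & E); apply Hno; eauto.
        * apply H, Hin, Hi.
      + intros m Hm; rewrite delta_diff; [ring|]. intros E; apply Hno; eauto. }
  assert (Hys : rsum 4 y = 1).
  { rewrite <- Hsum, (rsum_ext _ _ _ (fun i _ => Ex i)), rsum_swap.
    apply rsum_ext; intros m Hm. rewrite rsum_scal, rsum_delta; [lra|nia]. }
  assert (Hyp : forall m, 0 <= y m) by (intros; apply Hpos).
  (* The combination with weights [y] of the vertices (1,1,1), (1,-1,-1), (-1,1,-1), (-1,-1,1),
     whose inner products are 3 with themselves and -1 with each other. Hence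
     [tdot m v = 4 * y m - 1], and the vanishing weight at [m0] makes the gauge 1. *)
  set (v := fun i => match i with
    | 0%nat => y 0%nat + y 1%nat - y 2%nat - y 3%nat
    | 1%nat => y 0%nat - y 1%nat + y 2%nat - y 3%nat
    | _ => y 0%nat - y 1%nat - y 2%nat + y 3%nat end).
  assert (Hsum4 : y 0%nat + y 1%nat + y 2%nat + y 3%nat = 1) by (simpl in Hys; lra).
  assert (Hv : forall m, (m < 4)%nat -> tdot m v = 4 * y m - 1).
  { intros m Hm; destruct m as [|[|[|[|m]]]]; [| | | |lia]; simpl; lra. }
  assert (Hg : tgauge v = 1).
  { apply Rle_antisym.
    - destruct (tgauge_attained v) as (m & Hm & ->). rewrite (Hv m Hm).
      specialize (Hyp m); lra.
    - assert (H := tgauge_ge v m0 Hm0). rewrite (Hv m0 Hm0), Hy0 in H; lra. }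
  set (nu := sqrt (v 0%nat ^ 2 + v 1%nat ^ 2 + v 2%nat ^ 2)).
  assert (Hnu2 : nu ^ 2 = v 0%nat ^ 2 + v 1%nat ^ 2 + v 2%nat ^ 2).
  { apply pow2_sqrt. assert (A0 := pow2_ge_0 (v 0%nat)). assert (A1 := pow2_ge_0 (v 1%nat)).
    assert (A2 := pow2_ge_0 (v 2%nat)). lra. }
  assert (Hnu : 0 < nu).
  { assert (H0 : 0 <= nu) by apply sqrt_pos.
    destruct (Rle_lt_or_eq_dec 0 nu H0) as [|E]; [assumption|].
    rewrite <- E in Hnu2.
    assert (A0 := pow2_ge_0 (v 0%nat)). assert (A1 := pow2_ge_0 (v 1%nat)).
    assert (A2 := pow2_ge_0 (v 2%nat)).
    assert (B0 : v 0%nat = 0) by nra. assert (B1 : v 1%nat = 0) by nra.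
    assert (B2 : v 2%nat = 0) by nra.
    assert (H := Hv m0 Hm0). rewrite Hy0 in H.
    assert (T : tdot m0 v = 0)
      by (destruct m0 as [|[|[|m0]]]; unfold tdot; rewrite B0, B1, B2; ring).
    lra. }
  set (z := fun i => match i with
    | 0%nat => v 0%nat / nu | 1%nat => v 1%nat / nu | 2%nat => v 2%nat / nu
    | 3%nat => INR j | _ => 0 end).
  assert (Hzd : forall m, tdot m z = tdot m v / nu).
  { intros [|[|[|m]]]; simpl; field; lra. }
  assert (Hzg : tgauge z = / nu).
  { assert (Hi : 0 < / nu) by (apply Rinv_0_lt_compat, Hnu).
    replace (/ nu) with (/ nu * tgauge v) by (rewrite Hg; ring). unfold tgauge.
    rewrite <- !RmaxRmult by lra. rewrite !Hzd. f_equal; f_equal; field; lra. }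
  exists z; split.
  - split; [intros [|[|[|[|i]]]] Hi; try lia; reflexivity|].
    split; [exists j; split; [exact Hj|reflexivity]|].
    change ((v 0%nat / nu) ^ 2 + (v 1%nat / nu) ^ 2 + (v 2%nat / nu) ^ 2 = 1).
    transitivity ((v 0%nat ^ 2 + v 1%nat ^ 2 + v 2%nat ^ 2) / nu ^ 2); [field; lra|].
    rewrite <- Hnu2; field; lra.
  - apply functional_extensionality; intros i.
    rewrite (tmap_level n z j i Hj eq_refl), Ex. apply rsum_ext; intros m Hm; f_equal.
    unfold tweight; rewrite Hzd, Hzg, (Hv m Hm). field; lra.
Qed.

Lemma tetrahedral_spheres n :
  (1 <= n)%nat ->
  homeomorphic (n + n + 2 * n) (realization (n + n + 2 * n) n n (2 * n)) 4 (spheres n).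
Proof.
  intros Hn.
  apply (homeomorphic_of_same_fibres 4 (n + n + 2 * n) 4 (spheres n) _ (spheres n)
    (tmap n) (fun z => z)).
  - apply spheres_compact.
  - intros x Hx; apply Hx.
  - intros x Hx; apply Hx.
  - intros z; apply tmap_in, Hn.
  - intros x; apply tmap_surjective, Hn.
  - auto.
  - intros z Hz; exists z; auto.
  - apply tmap_continuous.
  - apply continuous_on_coords; intros i Hi; apply rcont_coord, Hi.
  - intros z z' Hz Hz'; split; [apply tmap_injective; assumption|intros ->; reflexivity].
Qed.

(** * The lattice of periods *)

Section Lattice.
Local Open Scope Z_scope.

(** A triangular basis (p, 0), (r, q). With d = gcd(n1, N) and g = gcd(d, n2), p = N / d is the
    least positive period along the first axis and q = d / g the least positive second coordinate of
    a period. *)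
Lemma period_lattice_basis (N n1 n2 : Z) : 0 < N ->
  exists p q r, 0 < p /\ 0 < q /\ forall a b,
    (N | a * n1 + b * n2) <-> exists m n, a = m * p + n * r /\ b = n * q.
Proof.
  intros HN.
  set (d := Z.gcd n1 N).
  assert (Hd : 0 < d).
  { assert (H0 := Z.gcd_nonneg n1 N).
    assert (d <> 0) by (intros E; apply Z.gcd_eq_0_r in E; lia). lia. }
  set (g := Z.gcd d n2).
  assert (Hg : 0 < g).
  { assert (H0 := Z.gcd_nonneg d n2).
    assert (g <> 0) by (intros E; apply Z.gcd_eq_0_l in E; lia). lia. }
  destruct (Z.gcd_divide_l n1 N) as [n1' E1]. destruct (Z.gcd_divide_r n1 N) as [p Ep].
  destruct (Z.gcd_divide_l d n2) as [q Eq]. destruct (Z.gcd_divide_r d n2) as [n2' E2].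
  fold d in E1, Ep. fold g in Eq, E2.
  destruct (Z.gcd_bezout n1 N d eq_refl) as (x & y & Hxy).
  assert (Hp : 0 < p) by nia. assert (Hq : 0 < q) by nia.
  (* The Bézout coefficient [x] of [n1] in d makes (r, q) a period. *)
  set (r := - (n2' * x)).
  assert (Hr : r * n1 + q * n2 = N * (n2' * y)).
  { unfold r. rewrite E2.
    replace (q * (n2' * g)) with (n2' * d) by (rewrite Eq at 1; ring).
    rewrite <- Hxy at 1; ring. }
  assert (C1 : Z.gcd n1' p = 1).
  { apply (Z.mul_reg_r _ _ d); [lia|]. rewrite Z.mul_1_l, <- Z.gcd_mul_mono_r_nonneg by lia.
    rewrite <- E1, <- Ep; reflexivity. }
  assert (C2 : Z.gcd q n2' = 1).
  { apply (Z.mul_reg_r _ _ g); [lia|]. rewrite Z.mul_1_l, <- Z.gcd_mul_mono_r_nonneg by lia.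
    rewrite <- Eq, <- E2; reflexivity. }
  exists p, q, r; split; [exact Hp|]; split; [exact Hq|]; intros a b; split.
  - intros [c Hc].
    assert (Hqb : (q | b)).
    { apply (Z.gauss q n2' b); [|exact C2].
      exists (c * p - a * n1'). apply (Z.mul_reg_r _ _ g); [lia|].
      replace ((c * p - a * n1') * q * g) with ((c * p - a * n1') * d) by (rewrite Eq at 1; ring).
      replace (n2' * b * g) with (b * n2) by (rewrite E2; ring).
      replace ((c * p - a * n1') * d) with (c * (p * d) - a * (n1' * d)) by ring.
      rewrite <- Ep, <- E1; lia. }
    destruct Hqb as [n Hn].
    assert (Hpa : (p | a - n * r)).
    { apply (Z.gauss p n1'); [|rewrite Z.gcd_comm; exact C1].
      exists (c - n * (n2' * y)). apply (Z.mul_reg_r _ _ d); [lia|].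
      replace ((c - n * (n2' * y)) * p * d) with ((c - n * (n2' * y)) * (p * d)) by ring.
      replace (n1' * (a - n * r) * d) with ((a - n * r) * (n1' * d)) by ring.
      rewrite <- Ep, <- E1.
      replace ((a - n * r) * n1) with (a * n1 + b * n2 - n * (r * n1 + q * n2))
        by (rewrite Hn; ring).
      rewrite Hr, Hc; ring. }
    destruct Hpa as [m Hm]. exists m, n; lia.
  - intros (m & n & -> & ->).
    exists (m * n1' + n * (n2' * y)).
    replace ((m * p + n * r) * n1 + n * q * n2) with (m * p * n1 + n * (r * n1 + q * n2)) by ring.
    rewrite Hr, E1, Ep at 1. rewrite Ep at 1. ring.
Qed.

Lemma shift_into_range (N a : Z) : 0 < N -> exists c, 1 <= a + c * N <= N.
Proof.
  intros HN; exists (- ((a - 1) / N)).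
  assert (H := Z.div_mod (a - 1) N ltac:(lia)).
  assert (B := Z.mod_pos_bound (a - 1) N HN). nia.
Qed.

End Lattice.

Definition ncomp (N n1 n2 : nat) : nat :=
  Z.to_nat (Z.gcd (Z.of_nat n1) (Z.gcd (Z.of_nat n2) (Z.of_nat N))).

Lemma nat_mod_eq_Z a b N :
  (0 < N)%nat -> ((a mod N = b mod N)%nat <-> (Z.of_nat N | Z.of_nat a - Z.of_nat b)%Z).
Proof.
  intros HN; split.
  - intros E. apply (f_equal Z.of_nat) in E. rewrite !Nat2Z.inj_mod in E.
    apply Z.mod_divide; [lia|]. rewrite Zminus_mod, E, Z.sub_diag. apply Z.mod_0_l; lia.
  - intros H. apply Nat2Z.inj; rewrite !Nat2Z.inj_mod.
    destruct H as [c Hc]. replace (Z.of_nat a) with (Z.of_nat b + c * Z.of_nat N)%Z by lia.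
    apply Z_mod_plus_full.
Qed.

(** By Bézout the multiple [g * (k / g)] is a combination of n1 and n2 modulo N; its coefficients
    may be shifted by multiples of N into 1..N. *)
Lemma vertex_reached N n1 n2 k :
  (0 < N)%nat -> exists A B, (1 <= A <= N)%nat /\ (1 <= B <= N)%nat /\
    ((k mod ncomp N n1 n2 + A * n1 + B * n2) mod N = k mod N)%nat.
Proof.
  intros HN. set (g := ncomp N n1 n2).
  assert (Hbez : exists x y w : Z,
    (x * Z.of_nat n1 + y * Z.of_nat n2 + w * Z.of_nat N = Z.of_nat g)%Z).
  { destruct (Z.gcd_bezout (Z.of_nat n1) (Z.gcd (Z.of_nat n2) (Z.of_nat N)) _ eq_refl)
      as (x & y & Hxy).
    destruct (Z.gcd_bezout (Z.of_nat n2) (Z.of_nat N) _ eq_refl) as (z & w & Hzw).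
    exists x, (y * z)%Z, (y * w)%Z. unfold g, ncomp.
    rewrite Z2Nat.id, <- Hxy, <- Hzw; [ring|apply Z.gcd_nonneg]. }
  destruct Hbez as (x & y & w & Hb).
  set (c := Z.of_nat (k / g)).
  destruct (shift_into_range (Z.of_nat N) (c * x) ltac:(lia)) as (e1 & He1).
  destruct (shift_into_range (Z.of_nat N) (c * y) ltac:(lia)) as (e2 & He2).
  exists (Z.to_nat (c * x + e1 * Z.of_nat N)), (Z.to_nat (c * y + e2 * Z.of_nat N)).
  split; [lia|]; split; [lia|].
  apply nat_mod_eq_Z; [exact HN|].
  rewrite !Nat2Z.inj_add, !Nat2Z.inj_mul, !Z2Nat.id by lia.
  assert (Hk := Nat.div_mod_eq k g). apply (f_equal Z.of_nat) in Hk.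
  rewrite Nat2Z.inj_add, Nat2Z.inj_mul in Hk. fold c in Hk. rewrite <- Hb in Hk.
  exists (e1 * Z.of_nat n1 + e2 * Z.of_nat n2 - c * w)%Z. rewrite Hk; ring.
Qed.

(** The gcd divides n1, n2 and N, so [j] and [j'] agree modulo it, and both are smaller. *)
Lemma component_unique N n1 n2 j j' A B A' B' :
  (0 < N)%nat -> (j < ncomp N n1 n2)%nat -> (j' < ncomp N n1 n2)%nat ->
  ((j + A * n1 + B * n2) mod N = (j' + A' * n1 + B' * n2) mod N)%nat -> j = j'.
Proof.
  intros HN Hj Hj' H. apply nat_mod_eq_Z in H; [|exact HN].
  set (g := ncomp N n1 n2) in *.
  assert (G1 : (Z.of_nat g | Z.of_nat n1)%Z).
  { unfold g, ncomp; rewrite Z2Nat.id by apply Z.gcd_nonneg; apply Z.gcd_divide_l. }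
  assert (G23 : (Z.of_nat g | Z.gcd (Z.of_nat n2) (Z.of_nat N))%Z).
  { unfold g, ncomp; rewrite Z2Nat.id by apply Z.gcd_nonneg; apply Z.gcd_divide_r. }
  assert (G2 : (Z.of_nat g | Z.of_nat n2)%Z) by (eapply Z.divide_trans; [exact G23|apply Z.gcd_divide_l]).
  assert (G3 : (Z.of_nat g | Z.of_nat N)%Z) by (eapply Z.divide_trans; [exact G23|apply Z.gcd_divide_r]).
  assert (D : (Z.of_nat g | Z.of_nat j - Z.of_nat j')%Z).
  { destruct G1 as [x1 X1], G2 as [x2 X2], G3 as [x3 X3], H as [c Hc].
    rewrite !Nat2Z.inj_add, !Nat2Z.inj_mul, X1, X2, X3 in Hc.
    exists (c * x3 - (Z.of_nat A - Z.of_nat A') * x1 - (Z.of_nat B - Z.of_nat B') * x2)%Z. nia. }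
  destruct D as [c Hc]. assert (c = 0)%Z by nia. subst c; lia.
Qed.

(** * The circle *)

Lemma cos_sin_shift x (m : Z) :
  cos (x + 2 * PI * IZR m) = cos x /\ sin (x + 2 * PI * IZR m) = sin x.
Proof.
  assert (H : forall (y : R) (k : nat), cos (y + 2 * PI * INR k) = cos y /\
    sin (y + 2 * PI * INR k) = sin y).
  { intros y k; replace (y + 2 * PI * INR k) with (y + 2 * INR k * PI) by ring.
    split; [apply cos_period|apply sin_period]. }
  destruct (Z.le_ge_cases 0 m) as [Hm|Hm].
  - destruct (H x (Z.to_nat m)) as [Hc Hs]. rewrite INR_IZR_INZ, Z2Nat.id in Hc, Hs by exact Hm.
    auto.
  - destruct (H (x + 2 * PI * IZR m) (Z.to_nat (- m))) as [Hc Hs].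
    rewrite INR_IZR_INZ, Z2Nat.id, opp_IZR in Hc, Hs by lia.
    replace (x + 2 * PI * IZR m + 2 * PI * - IZR m) with x in Hc, Hs by ring. auto.
Qed.

Lemma cos_sin_eq x y :
  cos x = cos y -> sin x = sin y -> exists m : Z, x = y + 2 * PI * IZR m.
Proof.
  intros Hc Hs.
  assert (Hd : cos (x - y) = 1).
  { rewrite cos_minus, Hc, Hs. assert (H := sin2_cos2 y). unfold Rsqr in H; lra. }
  assert (Hz : sin (x - y) = 0).
  { rewrite sin_minus, Hc, Hs; ring. }
  destruct (sin_eq_0_0 _ Hz) as [k Hk].
  destruct (Z.Even_or_Odd k) as [[m Hm]|[m Hm]]; subst k.
  - exists m. rewrite mult_IZR in Hk. lra.
  - exfalso. rewrite Hk, plus_IZR, mult_IZR in Hd.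
    replace ((2 * IZR m + 1) * PI) with (PI + 2 * PI * IZR m) in Hd by ring.
    rewrite (proj1 (cos_sin_shift PI m)), cos_PI in Hd; lra.
Qed.

Lemma unit_circle_angle x y : x ^ 2 + y ^ 2 = 1 -> exists t, cos t = x /\ sin t = y.
Proof.
  intros H. assert (Hx : -1 <= x <= 1) by (split; nra).
  assert (Hs : forall s, 0 <= s -> x ^ 2 + s ^ 2 = 1 -> sin (acos x) = s).
  { intros s H0 E; rewrite sin_acos by exact Hx.
    replace (1 - x²) with (s ^ 2) by (unfold Rsqr; lra). apply sqrt_pow2, H0. }
  destruct (Rle_dec 0 y) as [Hy|Hy].
  - exists (acos x); split; [apply cos_acos, Hx|apply Hs; assumption].
  - exists (- acos x); split; [rewrite cos_neg; apply cos_acos, Hx|].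
    rewrite sin_neg, (Hs (- y)); [ring|lra|rewrite <- H; ring].
Qed.

(** * The universal cover of the non-degenerate complexes *)

(* The piecewise linear function that is 1 at the origin and 0 at the other vertices of the
   triangulation of the plane with vertex set Z^2 and edge directions (1,0), (0,1), (1,1). *)
Definition hat (u v : R) : R :=
  Rmax 0 (1 - Rmax (Rabs u) (Rmax (Rabs v) (Rabs (u - v)))).

(* Image of [(A + u, B + v)] when the vertex [(A, B)] is sent to [k mod N]. *)
Definition cellpt (N n1 n2 k : nat) (u v : R) : nat -> R := fun i =>
  hat u v * delta (k mod N) i + hat (u - 1) v * delta ((k + n1) mod N) i +
  hat u (v - 1) * delta ((k + n2) mod N) i +
  hat (u - 1) (v - 1) * delta ((k + n1 + n2) mod N) i.

Lemma hat_00 u v : 0 <= u <= 1 -> 0 <= v <= 1 -> hat u v = 1 - Rmax u v.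
Proof.
  intros Hu Hv; unfold hat; rewrite (Rabs_pos_eq u), (Rabs_pos_eq v) by lra.
  unfold Rmax, Rabs; destruct (Rcase_abs _); repeat destruct (Rle_dec _ _); lra.
Qed.

Lemma hat_10 u v : 0 <= u <= 1 -> 0 <= v <= 1 -> hat (u - 1) v = Rmax 0 (u - v).
Proof.
  intros Hu Hv; unfold hat; rewrite (Rabs_left1 (u - 1)), (Rabs_pos_eq v) by lra.
  rewrite (Rabs_left1 (u - 1 - v)) by lra.
  unfold Rmax; repeat destruct (Rle_dec _ _); lra.
Qed.

Lemma hat_01 u v : 0 <= u <= 1 -> 0 <= v <= 1 -> hat u (v - 1) = Rmax 0 (v - u).
Proof.
  intros Hu Hv; unfold hat; rewrite (Rabs_left1 (v - 1)), (Rabs_pos_eq u) by lra.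
  rewrite (Rabs_pos_eq (u - (v - 1))) by lra.
  unfold Rmax; repeat destruct (Rle_dec _ _); lra.
Qed.

Lemma hat_11 u v : 0 <= u <= 1 -> 0 <= v <= 1 -> hat (u - 1) (v - 1) = Rmin u v.
Proof.
  intros Hu Hv; unfold hat; rewrite (Rabs_left1 (v - 1)), (Rabs_left1 (u - 1)) by lra.
  unfold Rmax, Rmin, Rabs; destruct (Rcase_abs _); repeat destruct (Rle_dec _ _); lra.
Qed.

Lemma hat_nonneg u v : 0 <= hat u v.
Proof. apply Rmax_l. Qed.

Lemma hat_far u v : 1 <= Rabs u \/ 1 <= Rabs v -> hat u v = 0.
Proof.
  intros H; unfold hat; apply Rmax_left.
  assert (A1 := Rmax_l (Rabs u) (Rmax (Rabs v) (Rabs (u - v)))).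
  assert (A2 := Rmax_r (Rabs u) (Rmax (Rabs v) (Rabs (u - v)))).
  assert (A3 := Rmax_l (Rabs v) (Rabs (u - v))).
  destruct H; lra.
Qed.

Lemma cellpt_mod N n1 n2 k k' u v :
  (0 < N)%nat -> (k mod N = k' mod N)%nat -> cellpt N n1 n2 k u v = cellpt N n1 n2 k' u v.
Proof.
  intros HN E; apply functional_extensionality; intros i; unfold cellpt.
  assert (H : forall c, ((k + c) mod N = (k' + c) mod N)%nat).
  { intros c; rewrite <- (Nat.Div0.add_mod_idemp_l k), E, Nat.Div0.add_mod_idemp_l; reflexivity. }
  rewrite <- !Nat.add_assoc, !H, E; reflexivity.
Qed.

Lemma delta_mod_shift N k e f :
  (0 < N)%nat -> delta ((k + e) mod N) ((k + f) mod N) = delta (e mod N) (f mod N).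
Proof.
  intros HN; unfold delta.
  destruct (Nat.eqb_spec ((k + f) mod N) ((k + e) mod N)) as [E|E];
    destruct (Nat.eqb_spec (f mod N) (e mod N)) as [F|F]; try reflexivity; exfalso.
  - apply F. apply nat_mod_eq_Z; [exact HN|]. apply nat_mod_eq_Z in E; [|exact HN].
    destruct E as [c Hc]; exists c; lia.
  - apply E. apply nat_mod_eq_Z; [exact HN|]. apply nat_mod_eq_Z in F; [|exact HN].
    destruct F as [c Hc]; exists c; lia.
Qed.

Lemma rsum_two M A f :
  (S A < M)%nat -> (forall a, (a < M)%nat -> a <> A -> a <> S A -> f a = 0) ->
  rsum M f = f A + f (S A).
Proof.
  intros HA H.
  rewrite (rsum_ext M f (fun a => delta A a * f a + delta (S A) a * f a)).
  - rewrite rsum_plus, !rsum_delta_mul by lia; reflexivity.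
  - intros a Ha. destruct (Nat.eq_dec a A) as [->|H1].
    + rewrite delta_same, delta_diff by lia; ring.
    + destruct (Nat.eq_dec a (S A)) as [->|H2].
      * rewrite delta_same, delta_diff by lia; ring.
      * rewrite H, !delta_diff by assumption; ring.
Qed.

Lemma far_from_cell (a A : nat) u :
  0 <= u <= 1 -> a <> A -> a <> S A -> 1 <= Rabs (INR A + u - INR a).
Proof.
  intros Hu H1 H2. destruct (Nat.lt_ge_cases a A) as [H|H].
  - assert (INR (S a) <= INR A) by (apply le_INR; lia). rewrite S_INR in H0.
    rewrite Rabs_pos_eq; lra.
  - assert (INR (A + 2) <= INR a) by (apply le_INR; lia). rewrite plus_INR in H0; simpl in H0.
    rewrite Rabs_left; lra.
Qed.

Lemma real_shift_into_range (N x : R) : 0 < N -> exists m : Z, 1 <= x + N * IZR m <= N + 1.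
Proof.
  intros HN. destruct (archimed ((x - 1) / N)) as [A1 A2].
  set (k := up ((x - 1) / N)) in *.
  assert (E : (x - 1) / N * N = x - 1) by (field; lra).
  exists (1 - k)%Z. rewrite minus_IZR. split; nra.
Qed.

Section Torus.

Variables N n1 n2 n3 : nat.
Hypothesis h1 : (1 <= n1)%nat.
Hypothesis h12 : (n1 < n2)%nat.
Hypothesis h23 : (n2 < n3)%nat.
Hypothesis hN : (n1 + n2 + n3)%nat = N.
Hypothesis hne : n3 <> (n1 + n2)%nat.

(* Since [n1 + n2 + n3 = N], the neighbours [i - n1], [i - n2], [i - n1 - n2] of the vertex
   [i] are [i + (n2 + n3)], [i + (n1 + n3)], [i + n3]. *)
Definition star_s (i : nat) (x : nat -> R) : R :=
  x ((i + n1) mod N)%nat + x ((i + (n1 + n2)) mod N)%nat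
  - x ((i + (n2 + n3)) mod N)%nat - x ((i + n3) mod N)%nat.

Definition star_t (i : nat) (x : nat -> R) : R :=
  x ((i + n2) mod N)%nat + x ((i + (n1 + n2)) mod N)%nat
  - x ((i + (n1 + n3)) mod N)%nat - x ((i + n3) mod N)%nat.

Lemma cellpt_at k e u v :
  cellpt N n1 n2 k u v ((k + e) mod N)%nat =
    hat u v * delta 0 (e mod N) + hat (u - 1) v * delta n1 (e mod N) +
    hat u (v - 1) * delta n2 (e mod N) + hat (u - 1) (v - 1) * delta (n1 + n2) (e mod N).
Proof.
  unfold cellpt.
  assert (E0 : (k mod N = (k + 0) mod N)%nat) by (f_equal; lia).
  rewrite E0, <- (Nat.add_assoc k n1 n2), !delta_mod_shift by lia.
  rewrite (Nat.mod_small 0), (Nat.mod_small n1), (Nat.mod_small n2), (Nat.mod_small (n1 + n2))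
    by lia.
  reflexivity.
Qed.

(** Compares one residue with the four corners of the cell. The arithmetic hypotheses of the section
    decide which ones can agree; this is where distinctness of the neighbours enters. *)
Ltac cell_value :=
  rewrite cellpt_at;
  match goal with |- context [Nat.modulo ?e N] => case_mod e N end;
  unfold delta;
  repeat match goal with
  | |- context [Nat.eqb ?a ?b] => destruct (Nat.eqb_spec a b); try (exfalso; lia)
  end; try lra.

(** The six neighbours of a lift lie at (1,0), (1,1), (0,1) and their opposites, so [star_s] and
    [star_t] average their offsets with the barycentric weights. As the neighbours are distinct
    modulo N, this average is the position of the point relative to the lift. *)
Lemma star_coordinates k u v ea eb :
  0 <= u <= 1 -> 0 <= v <= 1 -> (ea = 0 \/ ea = 1)%nat -> (eb = 0 \/ eb = 1)%nat ->
  hat (u - INR ea) (v - INR eb) <> 0 ->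
  let i := (k + (ea * n1 + eb * n2))%nat in
  star_s i (cellpt N n1 n2 k u v) = u - INR ea /\
  star_t i (cellpt N n1 n2 k u v) = v - INR eb.
Proof.
  intros Hu Hv Ha Hb Hw i.
  assert (W00 := hat_00 u v Hu Hv). assert (W10 := hat_10 u v Hu Hv).
  assert (W01 := hat_01 u v Hu Hv). assert (W11 := hat_11 u v Hu Hv).
  assert (Hm : u <= v /\ Rmax u v = v /\ Rmin u v = u /\ Rmax 0 (u - v) = 0 /\ Rmax 0 (v - u) = v - u \/
               v <= u /\ Rmax u v = u /\ Rmin u v = v /\ Rmax 0 (u - v) = u - v /\ Rmax 0 (v - u) = 0).
  { destruct (Rle_dec u v); [left|right]; repeat split; try lra;
      first [apply Rmax_left; lra | apply Rmax_right; lra | apply Rmin_left; lra | apply Rmin_right; lra]. }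
  unfold star_s, star_t, i; rewrite <- !(Nat.add_assoc k). clear i.
  set (F := fun e => cellpt N n1 n2 k u v ((k + e) mod N)).
  destruct Ha as [-> | ->], Hb as [-> | ->]; simpl INR in *; rewrite ?Rminus_0_r in Hw.
  - assert (V0 : F ((0 * n1 + 0 * n2) + n1)%nat = hat (u - 1) v) by (unfold F; cell_value).
    assert (V1 : F ((0 * n1 + 0 * n2) + (n1 + n2))%nat = hat (u - 1) (v - 1)) by (unfold F; cell_value).
    assert (V2 : F ((0 * n1 + 0 * n2) + (n2 + n3))%nat = 0) by (unfold F; cell_value).
    assert (V3 : F ((0 * n1 + 0 * n2) + n3)%nat = 0) by (unfold F; cell_value).
    assert (V4 : F ((0 * n1 + 0 * n2) + n2)%nat = hat u (v - 1)) by (unfold F; cell_value).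
    assert (V5 : F ((0 * n1 + 0 * n2) + (n1 + n3))%nat = 0) by (unfold F; cell_value).
    unfold F in *; rewrite V0, V1, V2, V3, V4, V5; split; lra.
  (* The corner (1,0) is not adjacent to (0,1) in the plane, yet its residue may be that of a
     neighbour, as when n2 = 2 n1. It does no harm because a point with positive weight at (0,1) has
     weight 0 there. *)
  - assert (Z10 : hat (u - 1) v = 0) by (destruct Hm as [Hm|Hm]; lra).
    assert (V0 : F ((0 * n1 + 1 * n2) + n1)%nat = hat (u - 1) (v - 1)) by (unfold F; cell_value).
    assert (V1 : F ((0 * n1 + 1 * n2) + (n1 + n2))%nat = 0) by (unfold F; cell_value).
    assert (V2 : F ((0 * n1 + 1 * n2) + (n2 + n3))%nat = 0) by (unfold F; cell_value).
    assert (V3 : F ((0 * n1 + 1 * n2) + n3)%nat = 0) by (unfold F; cell_value).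
    assert (V4 : F ((0 * n1 + 1 * n2) + n2)%nat = 0) by (unfold F; cell_value).
    assert (V5 : F ((0 * n1 + 1 * n2) + (n1 + n3))%nat = hat u v) by (unfold F; cell_value).
    unfold F in *; rewrite V0, V1, V2, V3, V4, V5; split; lra.
  - assert (Z01 : hat u (v - 1) = 0) by (destruct Hm as [Hm|Hm]; lra).
    assert (V0 : F ((1 * n1 + 0 * n2) + n1)%nat = 0) by (unfold F; cell_value).
    assert (V1 : F ((1 * n1 + 0 * n2) + (n1 + n2))%nat = 0) by (unfold F; cell_value).
    assert (V2 : F ((1 * n1 + 0 * n2) + (n2 + n3))%nat = hat u v) by (unfold F; cell_value).
    assert (V3 : F ((1 * n1 + 0 * n2) + n3)%nat = 0) by (unfold F; cell_value).
    assert (V4 : F ((1 * n1 + 0 * n2) + n2)%nat = hat (u - 1) (v - 1)) by (unfold F; cell_value).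
    assert (V5 : F ((1 * n1 + 0 * n2) + (n1 + n3))%nat = 0) by (unfold F; cell_value).
    unfold F in *; rewrite V0, V1, V2, V3, V4, V5; split; lra.
  - assert (V0 : F ((1 * n1 + 1 * n2) + n1)%nat = 0) by (unfold F; cell_value).
    assert (V1 : F ((1 * n1 + 1 * n2) + (n1 + n2))%nat = 0) by (unfold F; cell_value).
    assert (V2 : F ((1 * n1 + 1 * n2) + (n2 + n3))%nat = hat u (v - 1)) by (unfold F; cell_value).
    assert (V3 : F ((1 * n1 + 1 * n2) + n3)%nat = hat u v) by (unfold F; cell_value).
    assert (V4 : F ((1 * n1 + 1 * n2) + n2)%nat = 0) by (unfold F; cell_value).
    assert (V5 : F ((1 * n1 + 1 * n2) + (n1 + n3))%nat = hat (u - 1) v) by (unfold F; cell_value).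
    unfold F in *; rewrite V0, V1, V2, V3, V4, V5; split; lra.
Qed.

Lemma cellpt_sum k u v :
  0 <= u <= 1 -> 0 <= v <= 1 -> rsum N (cellpt N n1 n2 k u v) = 1.
Proof.
  intros Hu Hv; unfold cellpt.
  rewrite !rsum_plus, !rsum_scal, !rsum_delta by (apply Nat.mod_upper_bound; lia).
  rewrite hat_00, hat_10, hat_01, hat_11 by assumption.
  unfold Rmax, Rmin; repeat destruct (Rle_dec _ _); lra.
Qed.

Lemma cellpt_nonneg k u v i : 0 <= cellpt N n1 n2 k u v i.
Proof.
  unfold cellpt, delta.
  assert (H1 := hat_nonneg u v). assert (H2 := hat_nonneg (u - 1) v).
  assert (H3 := hat_nonneg u (v - 1)). assert (H4 := hat_nonneg (u - 1) (v - 1)).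
  repeat destruct (Nat.eqb _ _); lra.
Qed.

Lemma cellpt_support k u v i :
  cellpt N n1 n2 k u v i <> 0 ->
  exists ea eb, (ea = 0 \/ ea = 1)%nat /\ (eb = 0 \/ eb = 1)%nat /\
    hat (u - INR ea) (v - INR eb) <> 0 /\ i = ((k + (ea * n1 + eb * n2)) mod N)%nat.
Proof.
  intros H; unfold cellpt in H.
  assert (D : forall a, delta a i = 0 \/ i = a).
  { intros a; destruct (Nat.eq_dec i a); [auto|left; apply delta_diff; assumption]. }
  assert (T : forall w a, w * delta a i = 0 \/ w <> 0 /\ i = a).
  { intros w a; destruct (D a) as [->|E]; [left; ring|].
    destruct (Req_dec w 0) as [->|Hw]; [left; ring|auto]. }
  destruct (T (hat u v) (k mod N)%nat) as [E1|[Hw E]].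
  2: { exists 0%nat, 0%nat; simpl INR; rewrite !Rminus_0_r. repeat split; auto.
       rewrite E; f_equal; lia. }
  destruct (T (hat (u - 1) v) ((k + n1) mod N)%nat) as [E2|[Hw E]].
  2: { exists 1%nat, 0%nat; simpl INR; rewrite !Rminus_0_r. repeat split; auto.
       rewrite E; f_equal; lia. }
  destruct (T (hat u (v - 1)) ((k + n2) mod N)%nat) as [E3|[Hw E]].
  2: { exists 0%nat, 1%nat; simpl INR; rewrite !Rminus_0_r. repeat split; auto.
       rewrite E; f_equal; lia. }
  destruct (T (hat (u - 1) (v - 1)) ((k + n1 + n2) mod N)%nat) as [E4|[Hw E]].
  2: { exists 1%nat, 1%nat; simpl INR. repeat split; auto.
       rewrite E; f_equal; lia. }
  elim H; rewrite E1, E2, E3, E4; ring.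
Qed.

Lemma up_face k : (k < N)%nat ->
  simplex_C N n1 n2 n3 [k; (k + n1) mod N; (k + (n1 + n2)) mod N]%nat.
Proof.
  intros Hk; right; right; exists k; split; [exact Hk|left]. rewrite Nat.add_assoc; reflexivity.
Qed.

Lemma down_face k : (k < N)%nat ->
  simplex_C N n1 n2 n3 [(k + (n1 + n2)) mod N; (k + n2) mod N; k]%nat.
Proof.
  intros Hk; right; right; exists ((k + (n1 + n2)) mod N)%nat.
  split; [apply Nat.mod_upper_bound; lia|right].
  rewrite <- Nat.add_assoc, !Nat.Div0.add_mod_idemp_l.
  case_mods N; repeat (apply f_equal2; [lia|]); reflexivity.
Qed.

Lemma cellpt_in k u v :
  0 <= u <= 1 -> 0 <= v <= 1 -> realization N n1 n2 n3 (cellpt N n1 n2 k u v).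
Proof.
  intros Hu Hv.
  rewrite (cellpt_mod N n1 n2 k (k mod N)) by (rewrite ?Nat.Div0.mod_mod; lia).
  assert (Hk : (k mod N < N)%nat) by (apply Nat.mod_upper_bound; lia).
  set (l := (k mod N)%nat) in *; clearbody l.
  split; [|split; [|split]].
  - intros i Hi; apply NNPP; intros H.
    destruct (cellpt_support l u v i H) as (ea & eb & _ & _ & _ & E).
    assert (B := Nat.mod_upper_bound (l + (ea * n1 + eb * n2)) N ltac:(lia)). lia.
  - intros i; apply cellpt_nonneg.
  - apply cellpt_sum; assumption.
  - assert (El : (l mod N = l)%nat) by (apply Nat.mod_small, Hk).
    destruct (Rle_dec v u) as [Hvu|Hvu];
      [exists [l; (l + n1) mod N; (l + (n1 + n2)) mod N]%nat; split; [apply up_face, Hk|]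
      |exists [(l + (n1 + n2)) mod N; (l + n2) mod N; l]%nat; split; [apply down_face, Hk|]];
      intros i _ Hi; destruct (cellpt_support l u v i Hi) as (ea & eb & Ha & Hb & Hw & E);
      destruct Ha as [-> | ->], Hb as [-> | ->]; simpl INR in Hw;
      rewrite ?Rminus_0_r in Hw; cbn [Nat.mul] in E; rewrite ?Nat.add_0_r in E;
      rewrite ?Nat.add_0_l in E; cbn [In]; subst i; rewrite ?El; auto; exfalso; apply Hw.
    + rewrite hat_01 by assumption; apply Rmax_left; lra.
    + rewrite hat_10 by assumption; apply Rmax_left; lra.
Qed.

(** An edge of difference n3 and an inverted triangle starting at k lead back to k - n1 - n2 = k +
    n3, so the base corner of their cell is [(k + n3) mod N]. *)
Lemma simplex_in_cell s :
  simplex_C N n1 n2 n3 s ->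
  exists k, (k < N)%nat /\
    ((forall i, In i s -> i = k \/ i = ((k + n1) mod N)%nat \/ i = ((k + (n1 + n2)) mod N)%nat) \/
     (forall i, In i s -> i = k \/ i = ((k + n2) mod N)%nat \/ i = ((k + (n1 + n2)) mod N)%nat)).
Proof.
  assert (Hback : forall k, (k < N)%nat -> (((k + n3) mod N + (n1 + n2)) mod N = k)%nat).
  { intros k Hk. rewrite Nat.Div0.add_mod_idemp_l. case_mods N; lia. }
  intros [(k & Hk & ->)|[(k & j & Hk & [-> | [-> | ->]] & ->)|(k & Hk & [-> | ->])]].
  - exists k; split; [exact Hk|left]; cbn [In]; intuition.
  - exists k; split; [exact Hk|left]; cbn [In]; intuition.
  - exists k; split; [exact Hk|right]; cbn [In]; intuition.
  - exists ((k + n3) mod N)%nat; split; [apply Nat.mod_upper_bound; lia|left].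
    rewrite (Hback k Hk); cbn [In]; intuition.
  - exists k; split; [exact Hk|left]; rewrite Nat.add_assoc; cbn [In]; intuition.
  - exists ((k + n3) mod N)%nat; split; [apply Nat.mod_upper_bound; lia|right].
    rewrite (Hback k Hk), Nat.Div0.add_mod_idemp_l; cbn [In]; intros i Hi.
    destruct Hi as [Hi|[Hi|[Hi|[]]]]; [auto|right; left|left];
      rewrite <- Hi; case_mods N; lia.
Qed.

Lemma cellpt_surjective x :
  realization N n1 n2 n3 x ->
  exists k u v, 0 <= u <= 1 /\ 0 <= v <= 1 /\ x = cellpt N n1 n2 k u v.
Proof.
  intros (Hin & Hpos & Hsum & s & Hs & Hsup).
  assert (Hsp : forall i, x i <> 0 -> In i s).
  { intros i Hi; destruct (Nat.lt_ge_cases i N); [auto|]. elim Hi; apply Hin; assumption. }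
  destruct (simplex_in_cell s Hs) as (k & Hk & Hcell).
  assert (B1 := Nat.mod_upper_bound (k + n1) N ltac:(lia)).
  assert (B2 := Nat.mod_upper_bound (k + n2) N ltac:(lia)).
  assert (B3 := Nat.mod_upper_bound (k + (n1 + n2)) N ltac:(lia)).
  assert (D : k <> ((k + n1) mod N)%nat /\ k <> ((k + n2) mod N)%nat /\
    k <> ((k + (n1 + n2)) mod N)%nat /\ ((k + n1) mod N <> (k + (n1 + n2)) mod N)%nat /\
    ((k + n2) mod N <> (k + (n1 + n2)) mod N)%nat).
  { case_mods N; lia. }
  destruct D as (D1 & D2 & D3 & D4 & D5).
  assert (Ek : (k mod N = k)%nat) by (apply Nat.mod_small, Hk).
  exists k; destruct Hcell as [Hc|Hc].
  - assert (HS : supported N k ((k + n1) mod N) ((k + (n1 + n2)) mod N) x)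
      by (split; [|split; [|split]]; auto).
    assert (S1 := supported_sum N _ _ _ x Hk B1 B3 D1 D3 D4 HS).
    assert (E := supported_bary N _ _ _ x D1 D3 D4 HS).
    set (b := x ((k + n1) mod N)%nat) in *. set (c := x ((k + (n1 + n2)) mod N)%nat) in *.
    assert (0 <= x k) by apply Hpos. assert (0 <= b) by apply Hpos. assert (0 <= c) by apply Hpos.
    (* In the lower triangle the weights at (1,0) and (1,1) are u - v and v; solving for b and c
       gives these coordinates. *)
    exists (b + c), c; split; [lra|]; split; [lra|]. rewrite E at 1.
    apply functional_extensionality; intros i; unfold bary, cellpt.
    rewrite hat_00, hat_10, hat_01, hat_11, Ek, <- Nat.add_assoc by lra.
    rewrite (Rmax_left (b + c)), (Rmax_right 0), (Rmax_left 0), Rmin_right by lra.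
    replace (1 - (b + c)) with (x k) by lra. ring.
  - assert (HS : supported N k ((k + n2) mod N) ((k + (n1 + n2)) mod N) x)
      by (split; [|split; [|split]]; auto).
    assert (S1 := supported_sum N _ _ _ x Hk B2 B3 D2 D3 D5 HS).
    assert (E := supported_bary N _ _ _ x D2 D3 D5 HS).
    set (b := x ((k + n2) mod N)%nat) in *. set (c := x ((k + (n1 + n2)) mod N)%nat) in *.
    assert (0 <= x k) by apply Hpos. assert (0 <= b) by apply Hpos. assert (0 <= c) by apply Hpos.
    exists c, (b + c); split; [lra|]; split; [lra|]. rewrite E at 1.
    apply functional_extensionality; intros i; unfold bary, cellpt.
    rewrite hat_00, hat_10, hat_01, hat_11, Ek, <- Nat.add_assoc by lra.
    rewrite (Rmax_right c), (Rmax_left 0), (Rmax_right 0), Rmin_left by lra.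
    replace (1 - (b + c)) with (x k) by lra. ring.
Qed.

(** * The compact set and its map onto the realization *)

Let g := ncomp N n1 n2.

(** The squares have side N because (N, 0) and (0, N) are periods: each square meets every orbit of
    its plane. *)
Definition cover : space := fun x =>
  in_Rd 3 x /\ 1 <= x 0%nat <= INR N + 1 /\ 1 <= x 1%nat <= INR N + 1 /\
  exists j, (j < g)%nat /\ x 2%nat = INR j.

(* On [cover] only the vertices [(a, b)] with [0 <= a, b <= N + 2] contribute. *)
Definition cover_map (x : nat -> R) (i : nat) : R :=
  rsum (N + 3) (fun a => rsum (N + 3) (fun b =>
    hat (x 0%nat - INR a) (x 1%nat - INR b) *
    rsum g (fun j => bump (x 2%nat - INR j) * delta ((j + a * n1 + b * n2) mod N) i))).

Lemma cover_compact : seq_compact 3 cover.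
Proof.
  assert (H0 := pos_INR N). assert (Hg := pos_INR g).
  apply (closed_bounded_compact 3 cover (INR N + 1 + INR g)).
  - intros x Hx; apply Hx.
  - intros x i (Hin & Hs & Ht & j & Hj & Ej).
    destruct i as [|[|[|i]]].
    + apply Rabs_le_between; lra.
    + apply Rabs_le_between; lra.
    + rewrite Ej, Rabs_pos_eq by apply pos_INR. apply lt_INR in Hj; lra.
    + rewrite Hin, Rabs_R0 by lia; lra.
  - intros l Hin Hl; split; [exact Hin|].
    assert (Hcoord : forall i, (i < 2)%nat -> 1 <= l i <= INR N + 1).
    { intros i Hi; split.
      - apply Ropp_le_cancel, (closed_le 3 cover (fun x => - x i)); auto.
        + rcont_tac.
        + intros x (_ & Hs & Ht & _). destruct i as [|[|i]]; [lra|lra|lia].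
      - apply (closed_le 3 cover (fun x => x i)); auto.
        + rcont_tac.
        + intros x (_ & Hs & Ht & _). destruct i as [|[|i]]; [lra|lra|lia]. }
    split; [apply Hcoord; lia|]; split; [apply Hcoord; lia|].
    apply (closed_level 3 cover); auto. intros x Hx; apply Hx.
Qed.

Lemma cover_map_continuous : continuous_on 3 N cover cover_map.
Proof.
  apply continuous_on_coords; intros i Hi; unfold cover_map.
  apply (rcont_rsum 3 cover (N + 3) (fun a x => rsum (N + 3) (fun b =>
    hat (x 0%nat - INR a) (x 1%nat - INR b) *
    rsum g (fun j => bump (x 2%nat - INR j) * delta ((j + a * n1 + b * n2) mod N) i)))).
  intros a Ha.
  apply (rcont_rsum 3 cover (N + 3) (fun b x =>
    hat (x 0%nat - INR a) (x 1%nat - INR b) *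
    rsum g (fun j => bump (x 2%nat - INR j) * delta ((j + a * n1 + b * n2) mod N) i))).
  intros b Hb. apply rcont_mult.
  - unfold hat; rcont_tac.
  - apply (rcont_rsum 3 cover g
      (fun j x => bump (x 2%nat - INR j) * delta ((j + a * n1 + b * n2) mod N) i)).
    intros j Hj; unfold bump; rcont_tac.
Qed.

Lemma cover_map_local x A B j u v :
  (A <= N + 1)%nat -> (B <= N + 1)%nat -> (j < g)%nat -> 0 <= u <= 1 -> 0 <= v <= 1 ->
  x 0%nat = INR A + u -> x 1%nat = INR B + v -> x 2%nat = INR j ->
  cover_map x = cellpt N n1 n2 (j + A * n1 + B * n2) u v.
Proof.
  intros HA HB Hj Hu Hv E0 E1 E2; apply functional_extensionality; intros i.
  unfold cover_map, cellpt.
  set (F := fun a b => hat (INR A + u - INR a) (INR B + v - INR b) *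
    delta ((j + a * n1 + b * n2) mod N) i).
  rewrite (rsum_ext (N + 3) _ (fun a => rsum (N + 3) (fun b => F a b))).
  2: { intros a _; apply rsum_ext; intros b _; unfold F. rewrite E0, E1; f_equal.
       rewrite <- (rsum_delta_mul g j (fun l => delta ((l + a * n1 + b * n2) mod N) i) Hj).
       apply rsum_ext; intros l _; rewrite E2, bump_INR; reflexivity. }
  assert (Hrow : forall a, rsum (N + 3) (fun b => F a b) = F a B + F a (S B)).
  { intros a; apply rsum_two; [lia|]. intros b _ H1 H2; unfold F.
    rewrite hat_far; [ring|]. right; apply far_from_cell; assumption. }
  rewrite (rsum_ext _ _ _ (fun a _ => Hrow a)), (rsum_two (N + 3) A); [|lia|].
  2: { intros a _ H1 H2; unfold F. rewrite !hat_far; [ring| |];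
         left; apply far_from_cell; assumption. }
  unfold F; rewrite !S_INR.
  replace (INR A + u - INR A) with u by ring. replace (INR B + v - INR B) with v by ring.
  replace (INR A + u - (INR A + 1)) with (u - 1) by ring.
  replace (INR B + v - (INR B + 1)) with (v - 1) by ring.
  replace (j + S A * n1 + B * n2)%nat with (j + A * n1 + B * n2 + n1)%nat by lia.
  replace (j + A * n1 + S B * n2)%nat with (j + A * n1 + B * n2 + n2)%nat by lia.
  replace (j + S A * n1 + S B * n2)%nat with (j + A * n1 + B * n2 + n1 + n2)%nat by lia.
  ring.
Qed.

(** Taking [u] and [v] below 1 makes the cell unique, so that an integer translation changes [A] and
    [B] only. *)
Lemma cover_cell x :
  cover x -> exists A B j u v, (A <= N + 1)%nat /\ (B <= N + 1)%nat /\ (j < g)%nat /\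
    0 <= u < 1 /\ 0 <= v < 1 /\
    x 0%nat = INR A + u /\ x 1%nat = INR B + v /\ x 2%nat = INR j /\
    cover_map x = cellpt N n1 n2 (j + A * n1 + B * n2) u v.
Proof.
  intros (Hin & Hs & Ht & j & Hj & Ej).
  assert (Hfl : forall s, 1 <= s <= INR N + 1 ->
    exists A u, (A <= N + 1)%nat /\ 0 <= u < 1 /\ s = INR A + u).
  { intros s Hs'. destruct (nfloor_ex s ltac:(lra)) as [A HA].
    exists A, (s - INR A); split; [|split; lra].
    apply INR_le; rewrite plus_INR; simpl; lra. }
  destruct (Hfl _ Hs) as (A & u & HA & Hu & E0). destruct (Hfl _ Ht) as (B & v & HB & Hv & E1).
  exists A, B, j, u, v; repeat split; try assumption; try lra.
  apply cover_map_local; auto; lra.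
Qed.

Lemma cover_map_in x : cover x -> realization N n1 n2 n3 (cover_map x).
Proof.
  intros Hx; destruct (cover_cell x Hx) as (A & B & j & u & v & _ & _ & _ & Hu & Hv & _ & _ & _ & ->).
  apply cellpt_in; auto; lra.
Qed.

Lemma cover_map_surjective x :
  realization N n1 n2 n3 x -> exists z, cover z /\ cover_map z = x.
Proof.
  intros Hx.
  destruct (cellpt_surjective x Hx) as (k & u & v & Hu & Hv & ->).
  destruct (vertex_reached N n1 n2 k ltac:(lia)) as (A & B & HA & HB & E). fold g in E.
  assert (Hg : (k mod g < g)%nat).
  { apply Nat.mod_upper_bound. unfold g, ncomp; intros E0.
    assert (H := Z.gcd_nonneg (Z.of_nat n1) (Z.gcd (Z.of_nat n2) (Z.of_nat N))).
    assert (H' : Z.gcd (Z.of_nat n1) (Z.gcd (Z.of_nat n2) (Z.of_nat N)) = 0%Z) by lia.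
    apply Z.gcd_eq_0_l in H'; lia. }
  assert (RA : 1 <= INR A <= INR N) by (split; [apply (le_INR 1)|apply le_INR]; lia).
  assert (RB : 1 <= INR B <= INR N) by (split; [apply (le_INR 1)|apply le_INR]; lia).
  set (z := fun i => match i with
    | 0%nat => INR A + u | 1%nat => INR B + v | 2%nat => INR (k mod g) | _ => 0 end).
  exists z; split.
  - split; [intros [|[|[|i]]] Hi; try lia; reflexivity|].
    split; [simpl; lra|]; split; [simpl; lra|]. exists (k mod g)%nat; split; [exact Hg|reflexivity].
  - rewrite (cover_map_local z A B (k mod g) u v); auto; try lia.
    apply cellpt_mod; [lia|exact E].
Qed.

Definition same_orbit (x y : nat -> R) : Prop :=
  x 2%nat = y 2%nat /\ exists a b : Z,
    x 0%nat - y 0%nat = IZR a /\ x 1%nat - y 1%nat = IZR b /\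
    (Z.of_nat N | a * Z.of_nat n1 + b * Z.of_nat n2)%Z.

(* The positions of a point relative to the lifts of a vertex [i] of its carrier can be read
   off its barycentric coordinates, by [star_coordinates]. *)
Lemma cover_map_fibre_orbit x y : cover x -> cover y -> cover_map x = cover_map y -> same_orbit x y.
Proof.
  intros Hx Hy E.
  destruct (cover_cell x Hx) as (A & B & j & u & v & HA & HB & Hj & Hu & Hv & X0 & X1 & X2 & Ex).
  destruct (cover_cell y Hy) as (A' & B' & j' & u' & v' & HA' & HB' & Hj' & Hu' & Hv' & Y0 & Y1 & Y2 & Ey).
  set (k := (j + A * n1 + B * n2)%nat) in *. set (k' := (j' + A' * n1 + B' * n2)%nat) in *.
  (* The coordinates sum to 1, so the common image has a vertex in its carrier. *)
  assert (Hi : exists i, (i < N)%nat /\ cover_map x i <> 0).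
  { apply NNPP; intros Hno. assert (S := cellpt_sum k u v ltac:(lra) ltac:(lra)).
    rewrite <- Ex, rsum_0 in S; [lra|]. intros i Hi'; apply NNPP; intros H; apply Hno; eauto. }
  destruct Hi as (i & HiN & Hi).
  assert (Hi' : cover_map y i <> 0) by (rewrite <- E; exact Hi).
  rewrite Ex in Hi; rewrite Ey in Hi'.
  destruct (cellpt_support k u v i Hi) as (ea & eb & Ha & Hb & Hw & Ei).
  destruct (cellpt_support k' u' v' i Hi') as (ea' & eb' & Ha' & Hb' & Hw' & Ei').
  destruct (star_coordinates k u v ea eb) as [Ss St]; auto; try lra.
  destruct (star_coordinates k' u' v' ea' eb') as [Ss' St']; auto; try lra.
  assert (Hmod : forall (z : nat -> R) l, l mod N = i ->
    star_s l z = star_s i z /\ star_t l z = star_t i z).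
  { intros z l <-; unfold star_s, star_t; rewrite !Nat.Div0.add_mod_idemp_l; auto. }
  destruct (Hmod (cellpt N n1 n2 k u v) _ (eq_sym Ei)) as [M1 M2].
  destruct (Hmod (cellpt N n1 n2 k' u' v') _ (eq_sym Ei')) as [M1' M2'].
  rewrite M1 in Ss; rewrite M2 in St; rewrite M1' in Ss'; rewrite M2' in St'.
  (* The star coordinates depend only on [i] and on the common image, so both points have the same
     position relative to their lifts of [i]; the difference of these lifts is the required
     period. *)
  rewrite <- Ex, E, Ey in Ss, St.
  assert (Ev : ((j + (A + ea) * n1 + (B + eb) * n2) mod N =
                (j' + (A' + ea') * n1 + (B' + eb') * n2) mod N)%nat).
  { transitivity i; [rewrite Ei|rewrite Ei']; unfold k, k'; f_equal; lia. }
  assert (Ejj : j = j') by (apply (component_unique N n1 n2 _ _ _ _ _ _ ltac:(lia) Hj Hj' Ev)).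
  split; [rewrite X2, Y2, Ejj; reflexivity|].
  exists (Z.of_nat (A + ea) - Z.of_nat (A' + ea'))%Z, (Z.of_nat (B + eb) - Z.of_nat (B' + eb'))%Z.
  rewrite !minus_IZR, <- !INR_IZR_INZ, !plus_INR.
  split; [lra|]; split; [lra|].
  apply nat_mod_eq_Z in Ev; [|lia]. destruct Ev as [c Hc]; exists c. rewrite <- Hc, Ejj. nia.
Qed.

Lemma orbit_cover_map x y : cover x -> cover y -> same_orbit x y -> cover_map x = cover_map y.
Proof.
  intros Hx Hy (E2 & a & b & Ea & Eb & Hdiv).
  destruct (cover_cell x Hx) as (A & B & j & u & v & HA & HB & Hj & Hu & Hv & X0 & X1 & X2 & Ex).
  destruct (cover_cell y Hy) as (A' & B' & j' & u' & v' & HA' & HB' & Hj' & Hu' & Hv' & Y0 & Y1 & Y2 & Ey).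
  rewrite Ex, Ey.
  assert (Ej : j = j') by (apply INR_eq; lra). subst j'.
  assert (Hint : forall (C C' : nat) (w w' : R) (c : Z), 0 <= w < 1 -> 0 <= w' < 1 ->
    INR C + w - (INR C' + w') = IZR c -> (Z.of_nat C - Z.of_nat C' = c)%Z /\ w = w').
  { intros C C' w w' c Hw Hw' E.
    assert (Ec : (Z.of_nat C - Z.of_nat C' = c)%Z).
    { rewrite !INR_IZR_INZ in E.
      assert (L1 : IZR (Z.of_nat C - Z.of_nat C' - c) < IZR 1) by (rewrite !minus_IZR; lra).
      assert (L2 : IZR (-1) < IZR (Z.of_nat C - Z.of_nat C' - c)) by (rewrite !minus_IZR; lra).
      apply lt_IZR in L1. apply lt_IZR in L2. lia. }
    split; [exact Ec|]. rewrite <- Ec, minus_IZR, <- !INR_IZR_INZ in E. lra. }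
  destruct (Hint A A' u u' a Hu Hu') as [Ca ->]; [rewrite <- X0, <- Y0; exact Ea|].
  destruct (Hint B B' v v' b Hv Hv') as [Cb ->]; [rewrite <- X1, <- Y1; exact Eb|].
  apply cellpt_mod; [lia|]. apply nat_mod_eq_Z; [lia|].
  destruct Hdiv as [c Hc]; exists c. rewrite <- Hc, <- Ca, <- Cb. nia.
Qed.

(** * The map of the same compact set onto the tori *)

Section Parametrization.

Variables p q r : Z.
Hypothesis hp : (0 < p)%Z.
Hypothesis hq : (0 < q)%Z.
Hypothesis hbasis : forall a b,
  (Z.of_nat N | a * Z.of_nat n1 + b * Z.of_nat n2)%Z <->
  exists m n, (a = m * p + n * r /\ b = n * q)%Z.

(* Coordinates with respect to the basis [(p, 0)], [(r, q)] of the period lattice. *)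
Definition longitude (x : nat -> R) : R :=
  2 * PI * ((x 0%nat - IZR r * (x 1%nat * / IZR q)) * / IZR p).
Definition latitude (x : nat -> R) : R := 2 * PI * (x 1%nat * / IZR q).

Definition torus_map (x : nat -> R) (i : nat) : R :=
  match i with
  | 0%nat => (2 + cos (latitude x)) * cos (longitude x)
  | 1%nat => (2 + cos (latitude x)) * sin (longitude x)
  | 2%nat => sin (latitude x)
  | 3%nat => x 2%nat
  | _ => 0
  end.

Lemma torus_map_continuous : continuous_on 3 4 cover torus_map.
Proof.
  apply continuous_on_coords; intros i Hi.
  destruct i as [|[|[|[|i]]]]; [| | | |lia]; unfold torus_map, latitude, longitude; rcont_tac.
Qed.

Lemma torus_radius t l : sqrt (((2 + cos t) * cos l) ^ 2 + ((2 + cos t) * sin l) ^ 2) = 2 + cos t.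
Proof.
  assert (H := COS_bound t). assert (E := sin2_cos2 l). unfold Rsqr in E.
  replace (((2 + cos t) * cos l) ^ 2 + ((2 + cos t) * sin l) ^ 2)
    with ((2 + cos t) ^ 2 * (sin l * sin l + cos l * cos l)) by ring.
  rewrite E, Rmult_1_r. apply sqrt_pow2; lra.
Qed.

Lemma torus_map_in x : cover x -> tori g (torus_map x).
Proof.
  intros (_ & _ & _ & Hj); split; [intros [|[|[|[|i]]]] Hi; try lia; reflexivity|].
  split; [exact Hj|]. cbn [torus_map]. rewrite torus_radius.
  assert (E := sin2_cos2 (latitude x)). unfold Rsqr in E. lra.
Qed.

(** The angles are 2 PI times the coordinates in a basis of the periods, so periods are exactly the
    translations by integer coordinates. *)
Lemma same_orbit_angles x y :
  same_orbit x y <-> x 2%nat = y 2%nat /\ exists m n : Z,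
    longitude x = longitude y + 2 * PI * IZR m /\ latitude x = latitude y + 2 * PI * IZR n.
Proof.
  assert (Hp : 0 < IZR p) by (apply IZR_lt, hp).
  assert (Hq : 0 < IZR q) by (apply IZR_lt, hq).
  assert (HPI := PI_RGT_0). unfold longitude, latitude.
  split.
  - intros (E2 & a & b & Ea & Eb & Hd); split; [exact E2|].
    apply hbasis in Hd. destruct Hd as (m & n & -> & ->). exists m, n.
    rewrite plus_IZR, !mult_IZR in Ea. rewrite mult_IZR in Eb.
    replace (x 0%nat) with (y 0%nat + (IZR m * IZR p + IZR n * IZR r)) by lra.
    replace (x 1%nat) with (y 1%nat + IZR n * IZR q) by lra.
    split; field; lra.
  - intros (E2 & m & n & Em & En); split; [exact E2|].
    exists (m * p + n * r)%Z, (n * q)%Z. rewrite plus_IZR, !mult_IZR.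
    assert (En' : x 1%nat * / IZR q = y 1%nat * / IZR q + IZR n) by nra.
    assert (Em' : (x 0%nat - IZR r * (x 1%nat * / IZR q)) * / IZR p =
      (y 0%nat - IZR r * (y 1%nat * / IZR q)) * / IZR p + IZR m) by nra.
    assert (E1 : x 1%nat = y 1%nat + IZR n * IZR q).
    { replace (x 1%nat) with (x 1%nat * / IZR q * IZR q) by (field; lra).
      rewrite En'; field; lra. }
    assert (E0 : x 0%nat - IZR r * (x 1%nat * / IZR q) =
      y 0%nat - IZR r * (y 1%nat * / IZR q) + IZR m * IZR p).
    { replace (x 0%nat - IZR r * (x 1%nat * / IZR q))
        with ((x 0%nat - IZR r * (x 1%nat * / IZR q)) * / IZR p * IZR p) by (field; lra).
      rewrite Em'; field; lra. }
    rewrite En' in E0.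
    split; [lra|]; split; [lra|]. apply hbasis; exists m, n; auto.
Qed.

(** The distance to the axis is 2 + cos of the latitude, which is positive: it gives back this
    cosine and can then be cancelled to recover the longitude. *)
Lemma torus_map_fibre x y : torus_map x = torus_map y <-> same_orbit x y.
Proof.
  rewrite same_orbit_angles. split.
  - intros E.
    assert (E0 := f_equal (fun z => z 0%nat) E). assert (E1 := f_equal (fun z => z 1%nat) E).
    assert (E2 := f_equal (fun z => z 2%nat) E). assert (E3 := f_equal (fun z => z 3%nat) E).
    cbn [torus_map] in E0, E1, E2, E3.
    assert (R1 := torus_radius (latitude x) (longitude x)).
    rewrite E0, E1, torus_radius in R1.
    assert (Ec : cos (latitude x) = cos (latitude y)) by lra.
    assert (B := COS_bound (latitude y)). rewrite Ec in E0, E1.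
    split; [exact E3|].
    destruct (cos_sin_eq (longitude x) (longitude y)) as [m Hm].
    + apply (Rmult_eq_reg_l (2 + cos (latitude y))); lra.
    + apply (Rmult_eq_reg_l (2 + cos (latitude y))); lra.
    + destruct (cos_sin_eq _ _ Ec E2) as [n Hn]. exists m, n; auto.
  - intros (E2 & m & n & Em & En).
    destruct (cos_sin_shift (longitude y) m) as [C1 S1]. rewrite <- Em in C1, S1.
    destruct (cos_sin_shift (latitude y) n) as [C2 S2]. rewrite <- En in C2, S2.
    apply functional_extensionality; intros i; unfold torus_map.
    rewrite C1, S1, C2, S2, E2; reflexivity.
Qed.

Lemma torus_map_surjective y : tori g y -> exists x, cover x /\ torus_map x = y.
Proof.
  intros (Hin & (j & Hj & Ej) & E).
  assert (Hp : 0 < IZR p) by (apply IZR_lt, hp).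
  assert (Hq : 0 < IZR q) by (apply IZR_lt, hq).
  assert (HPI := PI_RGT_0).
  assert (HN0 : 0 < INR N) by (apply lt_0_INR; lia).
  set (rho := sqrt (y 0%nat ^ 2 + y 1%nat ^ 2)) in *.
  (* The equation of the torus gives [(rho - 2) ^ 2 <= 1]; hence division by [rho] is safe. *)
  assert (Hrho : 1 <= rho) by nra.
  assert (Hrho2 : rho ^ 2 = y 0%nat ^ 2 + y 1%nat ^ 2).
  { apply pow2_sqrt. assert (A0 := pow2_ge_0 (y 0%nat)). assert (A1 := pow2_ge_0 (y 1%nat)). lra. }
  destruct (unit_circle_angle (y 0%nat / rho) (y 1%nat / rho)) as (l & Cl & Sl).
  { transitivity ((y 0%nat ^ 2 + y 1%nat ^ 2) / rho ^ 2); [field; lra|].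
    rewrite <- Hrho2; field; lra. }
  destruct (unit_circle_angle (rho - 2) (y 2%nat) E) as (t & Ct & St).
  (* The point of the plane with latitude [t] and longitude [l]. Moving it by multiples of N in both
     coordinates brings it into [cover] without leaving its orbit. *)
  set (t0 := t / (2 * PI) * IZR q). set (s0 := l / (2 * PI) * IZR p + IZR r * (t / (2 * PI))).
  destruct (real_shift_into_range (INR N) s0 HN0) as (m & Hm).
  destruct (real_shift_into_range (INR N) t0 HN0) as (n & Hn).
  set (z0 := fun i => match i with 0%nat => s0 | 1%nat => t0 | 2%nat => INR j | _ => 0 end).
  set (z := fun i => match i with
    | 0%nat => s0 + INR N * IZR m | 1%nat => t0 + INR N * IZR n | 2%nat => INR j | _ => 0 end).
  exists z; split.
  - split; [intros [|[|[|i]]] Hi; try lia; reflexivity|].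
    split; [exact Hm|]; split; [exact Hn|]. exists j; split; [exact Hj|reflexivity].
  - transitivity (torus_map z0).
    + apply torus_map_fibre. split; [reflexivity|].
      exists (Z.of_nat N * m)%Z, (Z.of_nat N * n)%Z.
      rewrite !mult_IZR, <- !INR_IZR_INZ. simpl.
      split; [ring|]; split; [ring|].
      exists (m * Z.of_nat n1 + n * Z.of_nat n2)%Z; ring.
    + assert (El : longitude z0 = l) by (unfold longitude; simpl; unfold s0, t0; field; lra).
      assert (Et : latitude z0 = t) by (unfold latitude; simpl; unfold t0; field; lra).
      apply (in_Rd_ext 4); [intros [|[|[|[|i]]]] Hi; try lia; reflexivity|exact Hin|].
      intros i Hi; destruct i as [|[|[|[|i]]]]; [| | | |lia]; cbn [torus_map];
        rewrite ?El, ?Et, ?Cl, ?Sl, ?Ct, ?St; try (field; lra).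
      rewrite Ej; reflexivity.
Qed.

Lemma torus_homeomorphism : homeomorphic N (realization N n1 n2 n3) 4 (tori g).
Proof.
  apply (homeomorphic_of_same_fibres 3 N 4 cover _ _ cover_map torus_map).
  - exact cover_compact.
  - intros x Hx; apply Hx.
  - intros x Hx; apply Hx.
  - exact cover_map_in.
  - exact cover_map_surjective.
  - exact torus_map_in.
  - exact torus_map_surjective.
  - exact cover_map_continuous.
  - exact torus_map_continuous.
  - intros x y Hx Hy; rewrite torus_map_fibre; split.
    + apply cover_map_fibre_orbit; assumption.
    + apply orbit_cover_map; assumption.
Qed.

End Parametrization.

Lemma generic_tori : exists k, homeomorphic N (realization N n1 n2 n3) 4 (tori k).
Proof.
  destruct (period_lattice_basis (Z.of_nat N) (Z.of_nat n1) (Z.of_nat n2) ltac:(lia))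
    as (p & q & r & Hp & Hq & Hb).
  exists g; apply (torus_homeomorphism p q r); assumption.
Qed.

End Torus.

Theorem theorem6p7 (N n1 n2 n3 : nat)
  (h1 : (1 <= n1)%nat) (h12 : (n1 <= n2)%nat) (h23 : (n2 <= n3)%nat)
  (h3N : (n3 < N)%nat) (hsum : (n1 + n2 + n3)%nat = N) :
  is_surface N (realization N n1 n2 n3) ->
  (exists k, homeomorphic N (realization N n1 n2 n3) 4 (tori k)) \/
  (exists k, homeomorphic N (realization N n1 n2 n3) 4 (spheres k)).
Proof.
  intros Hsurf.
  destruct (Nat.eq_dec n1 n2) as [<-|Hne12].
  - destruct (Nat.eq_dec n3 (2 * n1)) as [->|Hne].
    + right; exists n1; subst N; apply tetrahedral_spheres, h1.
    + exfalso; exact (not_surface_equal_small N n1 n3 h1 h23 hsum Hne Hsurf).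
  - destruct (Nat.eq_dec n2 n3) as [<-|Hne23].
    + exfalso; apply (not_surface_equal_large N n1 n2 h1 ltac:(lia) hsum Hsurf).
    + destruct (Nat.eq_dec n3 (n1 + n2)) as [->|Hne].
      * exfalso; apply (not_surface_half N n1 n2 h1 ltac:(lia) hsum Hsurf).
      * left; apply generic_tori; lia.
Qed.
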